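(* Let $(P_x)_{x\in C}$ be an SSS Markov family on $(C,d)$. Then the generator of the associated Markov semigroup $(S^t)_{t\ge 0}$ on $\mathcal{C}(C)$ coincides, for some $\gamma,\theta\ge 0$, with the closure of the operator $A$ defined on cylindric functions $f=h\circ\pi_n$ ($n\in\mathbb{N}$, $h:L_n\to\mathbb{R}$) by $$Af(x)=\gamma\sum_{k=1}^n\theta^k\bigl(\langle h\rangle_{n,k,x}-h(\pi_nx)\bigr),\qquad x\in C.$$
   Context: Cantor set. $C=\{0,1\}^{\mathbb{N}}$ (the triadic Cantor set, with $x=\sum_{k\ge1}2x_k3^{-k}$ identified with the sequence $(x_k)_{k\in\mathbb{N}}$), $\mathbb{N}=\{1,2,\dots\}$, with the ultrametric $d(x,y)=3^{-c(x,y)}$, $c(x,y)=\min\{k: x_k\ne y_k\}$, $d(x,x)=0$. For $n\in\mathbb{N}$: $L_n=\{0,1\}^n$, $\pi_nx=(x_1,\dots,x_n)$, and $[v]=\{x\in C:\pi_nx=v\}$ for $v\in L_n$. For $x\in C$, $v\in L_n$ with $x\notin[v]$, $c(x,v)=\min\{k:x_k\neq v_k\}$. For $h:L_n\to\mathbb{R}$ and $1\le k\le n$, $$\langle h\rangle_{n,k,x}=2^{-(n-k)}\sum_{v\in L_n:\,c(x,v)=k}h(v).$$ A function $f:C\to\mathbb{R}$ is cylindric if $f=h\circ\pi_n$ for some $n$ and $h:L_n\to\mathbb{R}$. $\mathcal{C}(C)$ is the space of continuous real functions on $C$ with the sup norm. Markov families. Given a homogeneous Markov transition function $P(t,x,B)$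 ($t\ge0$, $x\in C$, $B$ Borel), a compatible Markov family $(P_x)_{x\in C}$ is a family of probability measures on càdlàg paths $[0,\infty)\to C$ such that, for the canonical process $X$, $P_x\{X(0)=x\}=1$ and under $P_x$ the process $X$ is Markov with transition function $P$. The semigroup is $(S^tf)(x)=\int_C f(y)P(t,x,dy)$, and its generator is $f\mapsto\lim_{t\downarrow0}(S^tf-f)/t$ with domain the set of $f\in\mathcal{C}(C)$ for which this limit exists uniformly. Stochastically continuous: $\lim_{t\downarrow0}P(t,x,U)=1$ for every open $U$ and $x\in U$. Feller: $S^t\mathcal{C}(C)\subset\mathcal{C}(C)$ for all $t\ge 0$. Isometry invariant: $P(t,g(x),g(B))=P(t,x,B)$ for every isometry $g$ of $(C,d)$ and all $t,x,B$. Confinement. For $T>0$, $v\in L_n$, $x\in[v]$, let $P_x^{v,T}$ be the law of $X_{[0,T]}$ (the restriction of $X$ to $[0,T]$) under $P_x$ conditioned on $\{X_t\in[v]\text{ for all }t\le T\}$. For stochastically continuous, isometry invariant families the conditioning event has positive probability and these laws are consistent in $T$; $P_x^v$ denotes the resulting measure on paths $[0,\infty)\to[v]$. Self-similar: for every $n\in\mathbb{N}$ there is a number $\alpha_n$ such that for every $v\in L_n$, $x\in[v]$, every similarity map $h:[v]\to C$ (bijection with $d(h(y),h(z))=3^nd(y,z)$), all $l\in\mathbb{N}$, times $t_1,\dots,t_l\ge0$ and Borel sets $B_1,\dots,B_l\subset[v]$, $$P_x^v\{X_{t_1}\in B_1,\dots,X_{t_l}\in B_l\}=P_{h(x)}\{X_{\alpha_nt_1}\in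 h(B_1),\dots,X_{\alpha_nt_l}\in h(B_l)\}.$$ SSS (symmetric self-similar): the Markov family is stochastically continuous, Feller, isometry invariant and self-similar, and the trajectories of the associated Markov process are a.s. càdlàg.
   Formalization: The time scales α_n in self-similarity are required to be positive: with α_n = 0 allowed, the process jumping at rate 1 to a uniform point of the opposite half of C is self-similar, but its rates (1, 0, 0, …) are not of the form γθ^k. *)

(* Defs.v *)
From HB Require Import structures.
From mathcomp Require Import all_boot all_order all_algebra.
From mathcomp Require Import all_classical all_reals all_analysis.

Set Implicit Arguments.
Unset Strict Implicit.
Unset Printing Implicit Defensive.

Import Order.TTheory GRing.Theory Num.Theory.
Import numFieldNormedType.Exports.

Local Open Scope classical_set_scope.
Local Open Scope ring_scope.

(* MathComp-Analysis. Coordinates are numbered from 0 here: the k-th coordinate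
   (k >= 1) of a point x or of a word v is the one of index k - 1. The levels
   c(x, y) and c(x, v) keep their usual values, starting from 1. *)

(* Borel sigma-algebra of the Cantor space *)
HB.instance Definition _ :=
  @isMeasurable.Build (sigma_display (@open cantor_space)) cantor_space
    <<s @open cantor_space >> (@sigma_algebra0 _ setT _) (@sigma_algebraC _ _)
    (@sigma_algebra_bigcup _ setT _).

Section cantor_metric.
Variable R : realType.
Implicit Types x y : cantor_space.

Definition cantor_dist x y : R :=
  match pselect (exists k, x k != y k) with
  | left xy => 3 ^- (ex_minn xy).+1
  | right _ => 0
  end.

Definition cantor_isometry (g : cantor_space -> cantor_space) :=
  bijective g /\ forall x y, cantor_dist (g x) (g y) = cantor_dist x y.

Definition cprefix n x : n.-tuple bool := [tuple x i | i < n].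

Definition cylinder n (v : n.-tuple bool) : set cantor_space :=
  [set x | cprefix n x = v].

(* A map from the cylinder of v to the Cantor space; the values of h outside of
   the cylinder are irrelevant. *)
Definition similarity n (v : n.-tuple bool) (h : cantor_space -> cantor_space) :=
  set_bij (cylinder v) setT h /\
  forall y z, cylinder v y -> cylinder v z ->
    cantor_dist (h y) (h z) = 3 ^+ n * cantor_dist y z.

(* c(x, v), with value n + 1 when x lies in the cylinder of v *)
Definition split_level n x (v : n.-tuple bool) : nat :=
  (find (fun i : 'I_n => x i != tnth v i) (enum 'I_n)).+1.

Definition level_avg n (h : n.-tuple bool -> R) (k : nat) x : R :=
  2 ^- (n - k) * \sum_(v : n.-tuple bool | split_level x v == k) h v.

Lemma cantor_dist_lt n x y :
  (cantor_dist x y < 3 ^- n) = [forall i : 'I_n, x i == y i].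
Proof.
rewrite /cantor_dist; case: pselect => [xy|nxy].
  case: ex_minnP => m xym minm.
  rewrite ltf_pV2 ?posrE ?exprn_gt0// ltr_eXn2l ?ltr1n// ltnS.
  apply/idP/forallP => [nm i|xyn].
    apply: contraTT (ltn_ord i) => /minm mi.
    by rewrite -leqNgt (leq_trans nm mi).
  rewrite leqNgt; apply/negP => mn.
  by move: (xyn (Ordinal mn)); rewrite (negPf xym).
rewrite invr_gt0 exprn_gt0//; apply/esym/forallP => i; apply/eqP.
by apply: contra_notP nxy => /eqP; exists i.
Qed.

(* The product topology of the Cantor space is the topology of its metric. *)
Lemma open_cantor_distP (U : set cantor_space) :
  open U <-> forall x, U x ->
    exists2 e : R, 0 < e & [set y | cantor_dist x y < e] `<=` U.
Proof.
split=> [oU x Ux|ballU].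
  suff [n nU] : exists n, [set y | cantor_dist x y < 3 ^- n] `<=` U.
    by exists (3 ^- n) => //; rewrite invr_gt0 exprn_gt0.
  apply: contrapT => /forallNP nU.
  have /choice[u uP] n : exists y, cantor_dist x y < 3 ^- n /\ ~ U y.
    by have /existsNP[y /not_implyP[]] := nU n; exists y.
  have ux : {ptws, u @ \oo --> (x : nat -> bool)}.
    apply/pointwise_cvgP => i; apply: cvg_near_cst; exists i.+1 => // n /= ni.
    have [+ _] := uP n; rewrite cantor_dist_lt => /forallP xu.
    by have /eqP := xu (Ordinal ni).
  have nU' : nbhs x U by exact: open_nbhs_nbhs.
  have [n _ /(_ n (leqnn n)) Un] := ux _ nU'.
  by have [_] := uP n; apply.
rewrite openE => x /ballU[e e0 eU].
have [n n3] : exists n, (3 ^- n : R) < e.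
  have /cvgr0_norm_lt/(_ _ e0)[n _ /(_ n (leqnn n))/=] :=
    @cvg_expr R 3^-1 ltac:(by rewrite ger0_norm ?invf_lt1// ltr1n).
  by rewrite exprVn ger0_norm ?invr_ge0 ?exprn_ge0//; exists n.
rewrite /interior; apply: (@filterS _ _ _ [set y : cantor_space |
    forall i : 'I_n, y i = x i]).
  move=> y xy; apply: eU => /=; rewrite (lt_trans _ n3)// cantor_dist_lt.
  by apply/forallP => i; rewrite xy.
have Fx : Filter (nbhs x) := nbhs_filter x.
have := @filter_forall _ 'I_n (fun i y => y i = x i) _ Fx.
apply => i; have /(_ [set x i]) := @proj_continuous nat (fun=> bool) i x.
by apply; exact: discrete_set1.
Qed.

End cantor_metric.

Section markov_families.
Variable R : realType.
Local Notation C := cantor_space.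

Lemma clip_ge0 (t : R) : 0 <= Num.max t 0.
Proof. by rewrite le_max lexx orbT. Qed.

(* max(t, 0) as a time; limits in time are taken along filters of the line. *)
Definition clip (t : R) : {nonneg R} := NngNum (clip_ge0 t).

(* Composing with clip extends w by the value w 0 to negative times, so that
   the left limit is no constraint at time 0. *)
Definition cadlag (w : {nonneg R} -> C) :=
  forall t : {nonneg R},
    w (clip s) @[s --> t%:num^'+] --> w t /\ cvg (w (clip s) @[s --> t%:num^'-]).

Record cadlag_path := CadlagPath {
  path_val :> {nonneg R} -> C ;
  path_cadlag : cadlag path_val }.

Lemma cadlag_cst (x : C) : cadlag (fun=> x).
Proof. by move=> t; split; [exact: cvg_cst | exact: is_cvg_cst]. Qed.

HB.instance Definition _ := gen_eqMixin cadlag_path.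
HB.instance Definition _ := gen_choiceMixin cadlag_path.
HB.instance Definition _ :=
  isPointed.Build cadlag_path (CadlagPath (cadlag_cst point)).

Definition coord_events (J : set {nonneg R}) : set (set cadlag_path) :=
  [set [set w : cadlag_path | B (w t)] | t in J & B in @measurable _ C].

HB.instance Definition _ :=
  @isMeasurable.Build (sigma_display (coord_events setT)) cadlag_path
    <<s coord_events setT >> (@sigma_algebra0 _ setT _) (@sigma_algebraC _ _)
    (@sigma_algebra_bigcup _ setT _).

(* events determined by the path on [0, T] *)
Definition past (T : {nonneg R}) : set (set cadlag_path) :=
  <<s coord_events [set t | t <= T] >>.

Implicit Types (K : {nonneg R} -> R.-pker C ~> C)
  (P : C -> probability cadlag_path R).

Definition transition_function K :=
  (forall x B, measurable B -> K 0%:nng x B = \d_x B) /\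
  (forall (s t : {nonneg R}) x B, measurable B ->
    K (s%:num + t%:num)%:nng x B = (\int[K s x]_y K t y B)%E).

(* The last clause says that K t (X_s) B is the conditional probability of
   X_(s+t) being in B given the past of s, under P x. *)
Definition markov_family K P :=
  [/\ transition_function K,
      forall x, P x [set w : cadlag_path | w 0%:nng = x] = 1%E &
      forall x (s t : {nonneg R}) B E, measurable B -> past s E ->
        P x (E `&` [set w : cadlag_path | B (w (s%:num + t%:num)%:nng)]) =
        (\int[P x]_(w in E) K t ((w : cadlag_path) s) B)%E].

Definition semigroup K (t : {nonneg R}) (f : C -> R) (x : C) : R :=
  \int[K t x]_y f y.

Definition stochastically_continuous K :=
  forall (U : set C) x, open U -> U x ->
    K (clip t) x U @[t --> 0^'+] --> 1%E.

Definition feller K :=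
  forall t (f : C -> R), continuous f -> continuous (semigroup K t f).

Definition isometry_invariant K :=
  forall g : C -> C, cantor_isometry R g ->
  forall (t : {nonneg R}) x B, measurable B -> K t (g x) (g @` B) = K t x B.

Definition confined n (v : n.-tuple bool) (T : {nonneg R}) : set cadlag_path :=
  [set w | forall t, t <= T -> cylinder v (w t)].

(* Q is the measure denoted P_x^v: on events determined by the path on [0, T] it
   is the law P_x^{v,T}, that is P_x conditioned on confinement up to time T.
   There is at most one such Q. *)
Definition confined_law P n (v : n.-tuple bool) (x : C)
    (Q : probability cadlag_path R) :=
  forall T : {nonneg R}, 0 < T%:num -> forall E, past T E ->
    Q E = (fine (P x (E `&` confined v T)) / fine (P x (confined v T)))%:E.

(* The time scale alpha is positive: with alpha = 0 allowed, a process whose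
   jumps are all from one half of the Cantor space to the other would be
   self-similar too, although its rates are not of the form gamma theta^k. *)
Definition self_similar P :=
  forall n, (0 < n)%N -> exists alpha : {posnum R},
  forall (v : n.-tuple bool) x, cylinder v x ->
  exists2 Q : probability cadlag_path R, confined_law P v x Q &
  forall h, similarity R v h ->
  forall l (t : 'I_l -> {nonneg R}) (B : 'I_l -> set C), (0 < l)%N ->
    (forall i, measurable (B i) /\ B i `<=` cylinder v) ->
    Q [set w : cadlag_path | forall i, B i (w (t i))] =
    P (h x) [set w : cadlag_path |
      forall i, (h @` B i) (w (alpha%:num * (t i)%:num)%:nng)].

(* The trajectories are cadlag by the choice of the path space. *)
Definition sss K P :=
  [/\ markov_family K P, stochastically_continuous K, feller K,
      isometry_invariant K & self_similar P].

(* Operators on C(C) are given by their graphs. {uniform C -> R} carries the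
   topology of uniform convergence, which on continuous functions is that of
   the sup norm; continuous functions form a closed subset. *)
Definition generator K : set ({uniform C -> R} * {uniform C -> R}) :=
  [set fg | continuous (fg.1 : C -> R) /\
    {uniform, (fun x => t^-1 * (semigroup K (clip t) fg.1 x - fg.1 x))
      @[t --> 0^'+] --> (fg.2 : C -> R)}].

Definition cylindric_operator (gamma theta : R) :
    set ({uniform C -> R} * {uniform C -> R}) :=
  [set fg | exists n (h : n.-tuple bool -> R), [/\ (0 < n)%N,
    fg.1 = h \o cprefix n &
    fg.2 = fun x => gamma * \sum_(1 <= k < n.+1)
             theta ^+ k * (level_avg h k x - h (cprefix n x))]].

End markov_families.

(* Main.v *)
(* For an isometry invariant kernel [K t x] is uniform on each sphere around [x],
   so the semigroup acts on functions of the first [n] coordinates, with the Haar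
   functions as eigenfunctions. The eigenvalues are multiplicative in [t], hence
   exponential, and the jump rate [r k] from a point to its [k]-th sphere is their
   combined derivative at 0. A union bound over dyadic grids shows that leaving a
   cylinder of generation 1 and being back at time [t] has probability [o(t)], so
   the rates of the confined process are those of [X]; self-similarity with
   [n = 1] then gives [r k.+1 = alpha * r k], that is [r k = gamma * theta ^+ k].
   Cylindric functions form a core because [1 - A] maps the functions of the first
   [n] coordinates onto themselves and the generator is closed and dissipative. *)
Require Import Defs.
From HB Require Import structures.
From mathcomp Require Import all_boot all_order all_algebra.
From mathcomp Require Import all_classical all_reals all_analysis.
From mathcomp Require Import measurable_realfun ring lra.
Import Order.TTheory GRing.Theory Num.Theory.
Import numFieldNormedType.Exports.
Local Open Scope classical_set_scope.
Local Open Scope ring_scope.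

Set Implicit Arguments.
Unset Strict Implicit.
Unset Printing Implicit Defensive.

Local Notation C := cantor_space.

(** * Words and isometries *)

(** Everything is expressed through the scalars [stay n t], the probability that the prefix of
    length n at time t is that of the starting point, excursions in between being allowed. The
    obstacle is that self-similarity speaks of confinement during a whole time interval, an event on
    uncountably many times for which the transition function gives no direct formula. Only its first
    order in t matters. Let eps k be the derivative at 0 of [1 - stay k] and c the probability of
    staying up to time t in the half of C containing the starting point. Then
    [1 - t * eps 1 <= c <= stay 1 t], so [1 - c] also has derivative eps 1. Self-similarity writes
    the probability of being confined and of ending in the cylinder of length k+1 around the start
    as [stay k (alpha t) * c], whence [eps (k+1) = eps 1 + alpha * eps k]. The rates r k are the
    successive differences of eps, so theta = alpha and gamma = eps 1 / alpha. *)

(** This is the inequality [cantor_dist x y < 3 ^- n] in boolean form; distances, cylinders and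
    split levels are all reduced to it. *)
Definition agree n (x y : C) : bool := [forall i : 'I_n, x i == y i].

Lemma agreeP n (x y : C) :
  reflect (forall i, (i < n)%N -> x i = y i) (agree n x y).
Proof.
apply: (iffP forallP) => [xy i ni|xy i]; first exact/eqP/(xy (Ordinal ni)).
by apply/eqP; exact: xy.
Qed.

Lemma agree_refl n (x : C) : agree n x x.
Proof. exact/agreeP. Qed.

Lemma agree_sym n (x y : C) : agree n x y = agree n y x.
Proof. by apply: eq_forallb => i; rewrite eq_sym. Qed.

Lemma agree_trans n (x y z : C) : agree n x y -> agree n y z -> agree n x z.
Proof.
by move=> /agreeP xy /agreeP yz; apply/agreeP => i ni; rewrite xy// yz.
Qed.

Lemma agree_le m n (x y : C) : (m <= n)%N -> agree n x y -> agree m x y.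
Proof.
move=> mn /agreeP xy; apply/agreeP => i im; apply: xy; exact: leq_trans mn.
Qed.

Lemma agreeS n (x y : C) : agree n.+1 x y = agree n x y && (x n == y n).
Proof.
apply/agreeP/andP => [xy|[/agreeP xy /eqP nxy] i].
  by split; [apply/agreeP => i /ltnW; exact: xy|rewrite xy].
by rewrite ltnS leq_eqVlt => /predU1P[->//|]; exact: xy.
Qed.

Lemma eq_cprefix n (x y : C) : (cprefix n x == cprefix n y) = agree n x y.
Proof.
apply/eqP/agreeP => [xy i ni|xy].
  by have := congr1 (fun t => tnth t (Ordinal ni)) xy; rewrite !tnth_mktuple.
by apply: eq_from_tnth => i; rewrite !tnth_mktuple xy.
Qed.

(** Padding by [false] picks a representative point in each cylinder, so that words can be compared
    with points by [agree]. *)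
Definition ext n (v : n.-tuple bool) : C := fun i => nth false v i.

Lemma cprefixK n (v : n.-tuple bool) : cprefix n (ext v) = v.
Proof. by apply: eq_from_tnth => i; rewrite tnth_mktuple (tnth_nth false). Qed.

Lemma cylinderE n (v : n.-tuple bool) (x : C) :
  cylinder v x <-> agree n x (ext v).
Proof.
rewrite /cylinder/=; split => [<-|].
  by rewrite -eq_cprefix cprefixK.
by rewrite -eq_cprefix cprefixK => /eqP.
Qed.

Lemma agree_cprefix k n (x y : C) : (k <= n)%N ->
  agree k y (ext (cprefix n x)) = agree k y x.
Proof.
move=> kn; have xx : agree k (ext (cprefix n x)) x.
  by apply: (agree_le kn); rewrite -eq_cprefix cprefixK.
apply/idP/idP => h; first exact: agree_trans xx.
by apply: agree_trans h _; rewrite agree_sym.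
Qed.

Lemma cylinder_cprefix n (x y : C) :
  cylinder (cprefix n x) y <-> agree n y x.
Proof. by rewrite cylinderE agree_cprefix. Qed.

(** The bridge from [find] to [agree]; the case [k = n] accounts for the conventional value [n.+1]
    of the level. *)
Lemma ltn_split_level k n (x : C) (v : n.-tuple bool) : (k <= n)%N ->
  (k < split_level x v)%N = agree k x (ext v).
Proof.
move=> kn; rewrite /split_level ltnS.
rewrite (@eq_find _ _ (preim val (fun i => x i != ext v i))); last first.
  by move=> i /=; rewrite (tnth_nth false).
rewrite -find_map val_enum_ord leqNgt -has_take_leq ?size_iota// take_iota (minn_idPl kn).
apply/hasPn/agreeP => /= xv i.
  by move=> ik; apply/eqP; rewrite -[_ == _]negbK xv// mem_iota.
by rewrite mem_iota/= negbK => ik; apply/eqP; exact: xv.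
Qed.

Lemma split_level_le n (x : C) (v : n.-tuple bool) : (split_level x v <= n.+1)%N.
Proof. by rewrite ltnS (leq_trans (find_size _ _))// size_enum_ord. Qed.

Lemma split_level_congr n (x x' : C) (v v' : n.-tuple bool) :
  (forall k, (k <= n)%N -> agree k x (ext v) = agree k x' (ext v')) ->
  split_level x v = split_level x' v'.
Proof.
move=> xv; apply/eqP; rewrite eqn_leq; apply/andP; split; rewrite leqNgt.
  apply/negP => vv; have v'n : (split_level x' v' <= n)%N.
    by rewrite -ltnS (leq_trans vv)// split_level_le.
  by move: vv; rewrite ltn_split_level// xv// -ltn_split_level// ltnn.
apply/negP => vv; have v'n : (split_level x v <= n)%N.
  by rewrite -ltnS (leq_trans vv)// split_level_le.
by move: vv; rewrite ltn_split_level// -xv// -ltn_split_level// ltnn.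
Qed.

Lemma split_level_max n (x : C) (v : n.-tuple bool) :
  (split_level x v == n.+1) = agree n x (ext v).
Proof. by rewrite -ltn_split_level// eqn_leq split_level_le. Qed.

Lemma split_levelE k n (x : C) (v : n.-tuple bool) : (k < n)%N ->
  (split_level x v == k.+1) = agree k x (ext v) && (x k != ext v k).
Proof.
move=> kn; rewrite eqn_leq -[(k < _)%N]/(k < _)%N ltn_split_level ?(ltnW kn)//.
rewrite leqNgt ltn_split_level// agreeS.
by case: (agree k x (ext v)) => //; rewrite ?andbF ?andbT.
Qed.

Lemma ext_cprefix n (x : C) i : (i < n)%N -> ext (cprefix n x) i = x i.
Proof.
have := agree_cprefix x (ext (cprefix n x)) (leqnn n).
by rewrite agree_refl => /esym/agreeP; apply.
Qed.

Lemma split_level_cprefixE k n (x y : C) : (k < n)%N ->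
  (split_level x (cprefix n y) == k.+1) = agree k x y && (x k != y k).
Proof. by move=> kn; rewrite split_levelE// agree_cprefix 1?ltnW// ext_cprefix. Qed.

Lemma split_level_extl n (x : C) (v : n.-tuple bool) :
  split_level (ext (cprefix n x)) v = split_level x v.
Proof.
by apply: split_level_congr => k kn; rewrite agree_sym agree_cprefix// agree_sym.
Qed.

Lemma cantor_dist_congr (R : realType) (x y x' y' : C) :
  (forall n, agree n x y = agree n x' y') ->
  cantor_dist R x y = cantor_dist R x' y'.
Proof.
have key (a b a' b' : C) : (forall n, agree n a b = agree n a' b') ->
    forall m, a m != b m -> exists2 i, (i <= m)%N & a' i != b' i.
  move=> ab m /negP abm; have : ~~ agree m.+1 a' b'.
    by rewrite -ab agreeS; apply/negP => /andP[_].
  by rewrite negb_forall => /existsP[i]; exists i => //; rewrite -ltnS.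
move=> xy; rewrite /cantor_dist; case: pselect => [p|np].
  case: pselect => [p'|np']; last first.
    by exfalso; case: p => m /(key _ _ _ _ xy m)[i _ xyi]; apply: np'; exists i.
  case: ex_minnP => m xym mle; case: ex_minnP => m' xym' mle'.
  suff -> : m = m' by [].
  apply/eqP; rewrite eqn_leq; apply/andP; split.
    by have [i im'] := key _ _ _ _ (fsym xy) _ xym'; move/mle/leq_trans; apply.
  by have [i im'] := key _ _ _ _ xy _ xym; move/mle'/leq_trans; apply.
case: pselect => // p'; exfalso; case: p' => m /(key _ _ _ _ (fsym xy) m)[i _ xyi].
by apply: np; exists i.
Qed.

Lemma isometry_involution (R : realType) (g : C -> C) : involutive g ->
  (forall n x y, agree n x y -> agree n (g x) (g y)) -> cantor_isometry R g.
Proof.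
move=> gK gag; split; first exact: inv_bij.
move=> x y; apply: cantor_dist_congr => n; apply/idP/idP; last exact: gag.
by move=> /gag; rewrite !gK.
Qed.

Lemma involution_cylinder n (v v' : n.-tuple bool) (g : C -> C) :
  involutive g -> (forall y, cylinder v (g y) <-> cylinder v' y) ->
  g @` cylinder v = cylinder v'.
Proof.
move=> gK gv; apply/seteqP; split => [_ [y vy <-]|y].
  by apply/gv; rewrite gK.
by move=> /gv vy; exists (g y).
Qed.

(** Translation by [z] in the group of binary sequences, applied only on the ball of points sharing
    [m] coordinates with [w]. When [z] vanishes on these coordinates the ball is preserved; for
    [m = 0] the translation is global. *)
Definition cxor m (w z y : C) : C := fun i => y i (+) (agree m y w && z i).

Section cxor.
Variables (m : nat) (w z : C).
Hypothesis zm : forall i, (i < m)%N -> z i = false.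

Lemma agree_cxor y : agree m (cxor m w z y) w = agree m y w.
Proof. by apply: eq_forallb => i; rewrite /cxor zm// andbF addbF. Qed.

Lemma cxorK : involutive (cxor m w z).
Proof.
by move=> y; apply/funext => i; rewrite {1}/cxor agree_cxor /cxor addbK.
Qed.

Lemma cxor_isometry (R : realType) : cantor_isometry R (cxor m w z).
Proof.
apply: isometry_involution cxorK _ => n x y xy; apply/agreeP => i ni.
rewrite /cxor (agreeP _ _ _ xy)//; have [im|mi] := ltnP i m.
  by rewrite zm// !andbF.
suff -> : agree m x w = agree m y w by [].
have {}xy := agree_le (leq_trans mi (ltnW ni)) xy.
by apply/idP/idP; apply: agree_trans => //; rewrite agree_sym.
Qed.

End cxor.

(** A global translation carries [x] to [x'] and [v] to some [u] that branches off [x'] at the same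
    level as [v']. Then [u] and [v'] lie in one ball avoiding [x'], and a translation restricted to
    this ball moves [u] to [v'] while fixing [x']. *)
Lemma isometry_split_level (R : realType) n (x x' : C) (v v' : n.-tuple bool) :
  split_level x v = split_level x' v' ->
  exists g g', [/\ cantor_isometry R g, cantor_isometry R g', g' (g x) = x' &
    g' @` (g @` cylinder v) = cylinder v'].
Proof.
move=> xv; pose z : C := fun i => x i (+) x' i.
have z0 i : (i < 0)%N -> z i = false by [].
pose g := cxor 0 x z.
have gE y i : g y i = y i (+) z i.
  by rewrite /g /cxor; have -> : agree 0 y x by apply/agreeP.
have gx : g x = x' by apply/funext => i; rewrite gE /z addKb.
pose u := cprefix n (g (ext v)).
have xu : split_level x' u = split_level x' v'.
  rewrite -xv; apply: split_level_congr => k kn; rewrite agree_cprefix// -gx.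
  apply/agreeP/agreeP => e i ik; have := e i ik; rewrite !gE; first exact: addIb.
  by move=> ->.
have gu : g @` cylinder v = cylinder u.
  apply: (@involution_cylinder _ v u g (cxorK _ z0)) => y.
  rewrite cylinderE cylinder_cprefix.
  apply: (iff_trans (B := agree n (g (g y)) (g (ext v)))).
    split=> [/agreeP e|/agreeP e]; apply/agreeP => i ik.
      by rewrite (gE (g y)) (gE (ext v)) (e i ik).
    by have := e i ik; rewrite (gE (g y)) (gE (ext v)) => /addIb.
  by rewrite /g (cxorK _ z0).
(* At level [n.+1] both words are the prefix of [x'], and the second isometry is the identity. *)
have [eu|neu] := boolP (split_level x' u == n.+1).
  exists g, (cxor 0 x' (fun=> false)); split.
  - exact: cxor_isometry.
  - by apply: cxor_isometry.
  - by rewrite gx; apply/funext => i; rewrite /cxor andbF addbF.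
  - have -> : cxor 0 x' (fun=> false) = id.
      by apply/funext => y; apply/funext => i; rewrite /cxor andbF addbF.
    rewrite image_id gu; suff -> : u = v' by [].
    rewrite -[u]cprefixK -[v']cprefixK; apply/eqP; rewrite eq_cprefix.
    move: (eu); rewrite xu split_level_max => h; move: eu.
    by rewrite split_level_max agree_sym => /agree_trans; apply.
have [k kn uk] : exists2 k, (k < n)%N & split_level x' u = k.+1.
  have : (0 < split_level x' u)%N by [].
  case E : (split_level x' u) => [//|k] _; exists k => //.
  move: neu (split_level_le x' u); rewrite E ltnS leq_eqVlt eqSS => /negPf -> /=.
  by [].
have := eqxx k.+1; rewrite -{1}uk split_levelE// => /andP[xuk nxuk].
have := eqxx k.+1; rewrite -{1}uk xu split_levelE// => /andP[xvk nxvk].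
(* Two bits that differ from the same bit [x' k] are equal. *)
have uv' : agree k.+1 (ext u) (ext v').
  rewrite agreeS; apply/andP; split.
    by apply: agree_trans xvk; rewrite agree_sym.
  by move: nxuk nxvk; do 3 case: (_ k).
pose t : C := fun i => ext u i (+) ext v' i.
have t0 i : (i < k.+1)%N -> t i = false.
  by move=> ik; rewrite /t (agreeP _ _ _ uv')// addbb.
exists g, (cxor k.+1 (ext u) t); split.
- exact: cxor_isometry.
- exact: cxor_isometry.
- rewrite gx; apply/funext => i; rewrite /cxor agreeS (negPf nxuk) andbF/=.
  by rewrite addbF.
- rewrite gu; apply: involution_cylinder (cxorK _ t0) _ => y; rewrite !cylinderE.
  split => /agreeP e; apply/agreeP => i ni.
    have yu : agree k.+1 y (ext u).
      by rewrite -(agree_cxor _ t0); apply: (agree_le kn); apply/agreeP.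
    have := e i ni; rewrite /cxor yu/= /t.
    by case: (y i) (ext u i) (ext v' i) => [] [] [].
  have yu : agree k.+1 y (ext u).
    apply: (agree_trans (y := ext v')); last by rewrite agree_sym.
    by apply: (agree_le kn); apply/agreeP.
  have := e i ni; rewrite /cxor yu/= /t.
  by case: (y i) (ext u i) (ext v' i) => [] [] [].
Qed.

(** Induction on the first letter: for [k = 0] it must differ from that of [x] and the tail is free;
    otherwise it is that of [x] and the tail is counted for the shifted point. *)
Lemma card_split_level n k (x : C) : (k < n)%N ->
  #|[pred v : n.-tuple bool | split_level x v == k.+1]| = (2 ^ (n - k.+1))%N.
Proof.
elim: n k x => [//|n IH] k x kn.
rewrite -sum1_card (reindex (fun p : bool * n.-tuple bool =>
  [tuple of p.1 :: p.2])) /=; last first.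
  exists (fun v : n.+1.-tuple bool => (thead v, [tuple of behead v])).
    by move=> [b v] _ /=; congr pair; apply/val_inj.
  by move=> v _; apply/val_inj; rewrite [in RHS](tuple_eta v).
pose sh : C := fun i => x i.+1.
pose lev b (v : n.-tuple bool) :=
  if k is k'.+1 then (x 0%N == b) && (split_level sh v == k'.+1)
  else x 0%N != b.
rewrite (eq_bigl (fun p => true && lev p.1 p.2)); last first.
  move=> [b v]; rewrite inE/= split_levelE// /lev; case: (k) kn => [|j] jn.
    by have -> : agree 0 x (ext [tuple of b :: v]) by apply/agreeP.
  rewrite split_levelE// andbA; congr (_ && _).
  apply/agreeP/andP => [e|[/eqP xb /agreeP e] [|i] ik//].
    by split; [apply/eqP/(e 0%N)|apply/agreeP => i ik; exact: (e i.+1)].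
  exact: e.
rewrite -(pair_big_dep xpredT lev (fun _ _ => 1%N))/=.
rewrite (bigD1 (if k is 0 then ~~ x 0%N else x 0%N))//=.
rewrite [X in (_ + X)%N]big1 ?addn0 /lev; last first.
  move=> b; case: (k) => [|j] xb; rewrite big_pred0// => v.
    by move: xb; case: (x 0%N) b => [] [].
  by rewrite eq_sym (negPf xb).
case: k kn {lev} => [|k] kn.
  rewrite (eq_bigl xpredT) => [|v]; last by case: (x 0%N).
  by rewrite sum1_card card_tuple card_bool subn1.
rewrite subSS -(IH k sh)// -sum1_card; apply: eq_bigl => v.
by rewrite eqxx.
Qed.

(** * Functions and integrals on the Cantor space *)

Section topology.
Variable R : realType.
Implicit Types f g : C -> R.

Lemma open_cylinder n (v : n.-tuple bool) : open (cylinder v).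
Proof.
apply/(open_cantor_distP R) => x /cylinderE vx.
exists (3 ^- n) => [|y /=]; first by rewrite invr_gt0 exprn_gt0.
rewrite cantor_dist_lt -/(agree n x y) => xy; apply/cylinderE.
by apply: agree_trans vx; rewrite agree_sym.
Qed.

Lemma nbhs_agree (x : C) (U : set C) :
  nbhs x U <-> exists n, forall y, agree n x y -> U y.
Proof.
split=> [|[n nU]].
  rewrite nbhsE => -[V [/(open_cantor_distP R) oV Vx] VU].
  have [e e0 eV] := oV _ Vx; have [n n3] : exists n, (3 ^- n : R) < e.
    have /cvgr0_norm_lt/(_ _ e0)[n _ /(_ n (leqnn n))/=] :=
      @cvg_expr R 3^-1 ltac:(by rewrite ger0_norm ?invf_lt1// ltr1n).
    by rewrite exprVn ger0_norm ?invr_ge0 ?exprn_ge0//; exists n.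
  exists n => y xy; apply/VU/eV => /=; apply: lt_trans n3.
  by rewrite cantor_dist_lt.
have : nbhs x (cylinder (cprefix n x)).
  by apply: open_nbhs_nbhs; split => //; exact: open_cylinder.
by apply: filterS => y /cylinder_cprefix; rewrite agree_sym; exact: nU.
Qed.

Lemma continuous_cylindric n (h : n.-tuple bool -> R) :
  continuous (h \o cprefix n : C -> R).
Proof.
move=> x; apply/cvgrPdist_lt => e e0; apply/nbhs_agree; exists n => y xy.
have /eqP xy' : cprefix n x == cprefix n y by rewrite eq_cprefix.
by rewrite /= xy' subrr normr0.
Qed.

(** Uniform continuity by compactness, the prefix length tending to infinity as the parameter of the
    near-covering property. *)
Lemma continuous_agree f : continuous f -> forall e, 0 < e ->
  exists n, forall x y : C, agree n x y -> `|f x - f y| <= e.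
Proof.
move=> fc e e0; have e20 : 0 < e / 2 by rewrite divr_gt0.
have := cantor_space_compact => /compact_near_coveringP.
move=> /(_ nat \oo (fun n x => forall y, agree n x y -> `|f x - f y| <= e)).
case=> [x _|n _ /(_ n (leqnn n)) nP]; last by exists n => x y; exact: nP.
have /cvgrPdist_lt/(_ _ e20)/nbhs_agree[n nf] := fc x.
exists ([set y | agree n x y], [set k | (n <= k)%N]) => /=.
  split; last by exists n.
  by apply/nbhs_agree; exists n.
move=> [x' k] /= [xx' nk] y x'y; rewrite (le_trans (ler_distD (f x) _ _))//.
rewrite (splitr e) lerD//.
  by rewrite distrC ltW// nf.
by rewrite ltW// nf//; apply: agree_trans xx' (agree_le nk x'y).
Qed.

Lemma cylindric_approx f : continuous f -> forall e, 0 < e ->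
  exists n (h : n.-tuple bool -> R),
    (0 < n)%N /\ forall x, `|f x - h (cprefix n x)| <= e.
Proof.
move=> fc e e0; have [n nf] := continuous_agree fc e0.
(* One extra coordinate ensures the positive length that [cylindric_operator] asks for. *)
exists n.+1, (f \o @ext n.+1); split => // x; apply: nf.
apply: agree_le (leqnSn n) _; rewrite agree_sym.
by rewrite -eq_cprefix cprefixK.
Qed.

Lemma continuous_bounded f : continuous f ->
  exists M, 0 < M /\ forall x, `|f x| <= M.
Proof.
move=> fc; have [n [h [_ fh]]] := cylindric_approx fc ltr01.
exists (\sum_v `|h v| + 1); split => [|x].
  by rewrite ltr_wpDl// sumr_ge0.
rewrite -[f x](subrK (h (cprefix n x))) (le_trans (ler_normD _ _))// addrC.
by rewrite lerD// (bigD1 (cprefix n x))//= lerDl sumr_ge0.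
Qed.

Lemma measurable_open (U : set C) : open U -> measurable U.
Proof. by move=> oU; apply: sub_sigma_algebra. Qed.

Lemma measurable_cylinder n (v : n.-tuple bool) : measurable (cylinder v).
Proof. by apply: measurable_open; exact: open_cylinder. Qed.

Lemma measurable_point (x : C) : measurable [set x].
Proof.
rewrite -(setCK [set x]); apply: measurableC; apply: measurable_open.
rewrite openC; apply: accessible_closed_set1.
by apply: hausdorff_accessible; exact: cantor_space_hausdorff.
Qed.

Lemma continuous_measurable f : continuous f -> measurable_fun setT f.
Proof.
move=> fc; apply: (@measurability _ _ _ _ _ _ (@RGenOpens.G R)).
  exact: RGenOpens.measurableE.
move=> _ [_ [a [b ->] <-]]; rewrite setTI; apply: measurable_open.
by apply: open_comp => [x _|]; [exact: fc|exact: itv_open].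
Qed.

End topology.

Section integral.
Variables (R : realType) (mu : {measure set C -> \bar R}).
Hypothesis mu1 : mu setT = 1%E.
Implicit Types f g : C -> R.

Lemma total1_fin_num A : measurable A -> mu A \is a fin_num.
Proof. by apply: lty_fin_num_fun; rewrite mu1 ltry. Qed.

Lemma continuous_integrable f : continuous f -> mu.-integrable setT (EFin \o f).
Proof.
move=> fc; apply: measurable_bounded_integrable => //.
- by rewrite mu1 ltry.
- exact: continuous_measurable.
- have [M [_ fM]] := continuous_bounded fc; exists M; split; first exact: num_real.
  by move=> N MN x _; exact: le_trans (fM x) (ltW MN).
Qed.

Lemma dist_Rintegral f g e : continuous f -> continuous g ->
  (forall x, `|f x - g x| <= e) -> `|\int[mu]_x f x - \int[mu]_x g x| <= e.
Proof.
move=> fc gc fge; rewrite -RintegralB//; try exact: continuous_integrable.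
have fgc : continuous (fun x => f x - g x).
  by move=> x; apply: cvgB; [exact: fc|exact: gc].
apply: le_trans (le_normr_Rintegral _ _) _ => //.
  exact: continuous_integrable.
have -> : e = \int[mu]_x e by rewrite Rintegral_cst// mu1 mulr1.
apply: le_Rintegral => //; apply: continuous_integrable => x.
  exact: continuous_comp (fgc x) (@norm_continuous _ _ _).
exact: cvg_cst.
Qed.

Lemma Rintegral_cylindric n (h : n.-tuple bool -> R) :
  \int[mu]_x h (cprefix n x) = \sum_v h v * fine (mu (cylinder v)).
Proof.
have hE x : (h (cprefix n x))%:E =
    (\sum_(v : n.-tuple bool) (h v * \1_(cylinder v) x)%:E)%E.
  rewrite sumEFin; congr EFin.
  rewrite (bigD1 (cprefix n x))//= big1 => [|v vx].
    by rewrite indicE mem_set// mulr1 addr0.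
  by rewrite indicE memNset ?mulr0// => /= vx'; rewrite vx' eqxx in vx.
have iv (v : n.-tuple bool) : mu.-integrable setT (EFin \o \1_(cylinder v)).
  apply: measurable_bounded_integrable => //.
  - by rewrite mu1 ltry.
  - by apply: measurable_indic; exact: (measurable_cylinder R).
  - exists 1; split=> [|M M1 x _]; first exact: num_real.
    rewrite /= indicE; apply: le_trans (ltW M1).
    by case: (_ \in _); rewrite ?normr0 ?normr1.
rewrite /Rintegral (eq_integral (fun x => \sum_(v : n.-tuple bool)
  (h v * \1_(cylinder v) x)%:E)%E) => [|x _]; last exact: hE.
have Ev (v : n.-tuple bool) : (\int[mu]_x (h v * \1_(cylinder v) x)%:E)%E =
    (h v * fine (mu (cylinder v)))%:E.
  under eq_integral do rewrite EFinM.
  rewrite (integralZl measurableT (iv v)) /= integral_indic ?setIT//.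
    by rewrite EFinM fineK//; apply: total1_fin_num; exact: (measurable_cylinder R).
  exact: (measurable_cylinder R).
rewrite integral_sum//; last first.
  by move=> v; under eq_fun do rewrite EFinM; apply: integrableZl (iv v).
by under eq_bigr do rewrite Ev; rewrite sumEFin.
Qed.

Lemma sum_cylinder n :
  \sum_(v : n.-tuple bool) fine (mu (cylinder v)) = 1.
Proof.
have := @Rintegral_cylindric n (fun=> 1); rewrite Rintegral_cst// mu1 mulr1 => ->.
by apply: eq_bigr => v _; rewrite mul1r.
Qed.

End integral.

(** * Isometry invariant kernels *)

Definition zeros : C := fun=> false.

Definition flip n (x : C) : C := fun i => x i (+) (i == n).

Lemma agree_flip n (x : C) : agree n x (flip n x).
Proof. by apply/agreeP => i ni; rewrite /flip (ltn_eqF ni) addbF. Qed.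

Lemma cylinder_split n (y : C) : cylinder (cprefix n y) =
  cylinder (cprefix n.+1 y) `|` cylinder (cprefix n.+1 (flip n y)).
Proof.
apply/seteqP; split => z /=; last first.
  move=> [] /cylinder_cprefix; rewrite agreeS => /andP[zy _];
    apply/cylinder_cprefix => //.
  by apply: agree_trans zy _; rewrite agree_sym agree_flip.
move=> /cylinder_cprefix zy; have [e|ne] := eqVneq (z n) (y n).
  by left; apply/cylinder_cprefix; rewrite agreeS zy e eqxx.
right; apply/cylinder_cprefix; rewrite agreeS (agree_trans zy (agree_flip n y)).
by rewrite /flip eqxx; move: ne; case: (z n) (y n) => [] [].
Qed.

Section kernel.
Variables (R : realType) (K : {nonneg R} -> R.-pker C ~> C).
Implicit Types t s : {nonneg R}.

Definition cyl_prob t n (v : n.-tuple bool) (x : C) : R :=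
  fine (K t x (cylinder v)).

(** The starting point [zeros] is a mere choice: [cyl_prob_stay] shows that all points give the same
    value. *)
Definition stay n t : R := cyl_prob t (cprefix n zeros) zeros.

Lemma K1 t x : K t x setT = 1%E.
Proof. exact: prob_kernel. Qed.

Lemma cyl_probE t n (v : n.-tuple bool) x :
  K t x (cylinder v) = (cyl_prob t v x)%:E.
Proof.
by rewrite fineK// (total1_fin_num (K1 t x))//; exact: (measurable_cylinder R).
Qed.

Lemma cyl_probC t n (v : n.-tuple bool) x :
  K t x (~` cylinder v) = (1 - cyl_prob t v x)%:E.
Proof.
have mv := measurable_cylinder R v.
have := measureU (K t x) mv (measurableC mv) (setICr _).
rewrite setUCr /= cyl_probE [X in X = _](K1 t x).
case: (K t x (~` cylinder v)) => [r| |]//= -[rE].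
by congr EFin; apply/esym/eqP; rewrite subr_eq addrC; apply/eqP.
Qed.

Lemma cyl_prob_ge0 t n (v : n.-tuple bool) x : 0 <= cyl_prob t v x.
Proof. by rewrite fine_ge0. Qed.

Lemma cyl_prob_children t n (y x : C) : cyl_prob t (cprefix n y) x =
  cyl_prob t (cprefix n.+1 y) x + cyl_prob t (cprefix n.+1 (flip n y)) x.
Proof.
rewrite -fineD -?cyl_probE//; try by rewrite cyl_probE.
rewrite /cyl_prob cylinder_split measureU//; try exact: (measurable_cylinder R).
apply/seteqP; split => // z /= [/cylinder_cprefix + /cylinder_cprefix].
rewrite !agreeS => /andP[_ /eqP ->] /andP[_].
by rewrite /flip eqxx; case: (y n).
Qed.

Lemma semigroup_sum t n (h : n.-tuple bool -> R) x :
  semigroup K t (h \o cprefix n) x = \sum_v h v * cyl_prob t v x.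
Proof. exact: Rintegral_cylindric (K1 t x) _ _. Qed.

Lemma sum_cyl_prob t n x : \sum_(v : n.-tuple bool) cyl_prob t v x = 1.
Proof. exact: sum_cylinder (K1 t x) n. Qed.

Lemma semigroup_contraction t (f g : C -> R) e x :
  continuous f -> continuous g -> (forall y, `|f y - g y| <= e) ->
  `|semigroup K t f x - semigroup K t g x| <= e.
Proof. exact: dist_Rintegral (K1 t x) _ _ _. Qed.

Lemma semigroupB t (f g : C -> R) x : continuous f -> continuous g ->
  semigroup K t (fun y => f y - g y) x = semigroup K t f x - semigroup K t g x.
Proof.
by move=> fc gc; apply: RintegralB => //; exact: continuous_integrable (K1 t x) _ _.
Qed.

Lemma semigroupD t (f g : C -> R) x : continuous f -> continuous g ->
  semigroup K t (fun y => f y + g y) x = semigroup K t f x + semigroup K t g x.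
Proof.
by move=> fc gc; apply: RintegralD => //; exact: continuous_integrable (K1 t x) _ _.
Qed.

Lemma semigroupZ t (f : C -> R) a x : continuous f ->
  semigroup K t (fun y => a * f y) x = a * semigroup K t f x.
Proof.
by move=> fc; apply: RintegralZl => //; exact: continuous_integrable (K1 t x) _ _.
Qed.

Hypothesis Kiso : isometry_invariant K.

Lemma cyl_prob_split_level t n (v v' : n.-tuple bool) x x' :
  split_level x v = split_level x' v' -> cyl_prob t v x = cyl_prob t v' x'.
Proof.
move=> /(isometry_split_level R)[g [g' [giso g'iso gx gv]]].
have mv : measurable (cylinder v) := measurable_cylinder R v.
(* The second use of invariance is on an image set, whose measurability comes from writing it as the
   preimage of [cylinder v'] under the continuous map [g']. *)
have mg : measurable (g @` cylinder v).
  have [[f fK gK] _] := giso.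
  have -> : g @` cylinder v = g' @^-1` cylinder v'.
    have [[f' g'K f'K] _] := g'iso.
    rewrite -gv; apply/seteqP; split => [y yv /=|y /= [z zv /(can_inj g'K) <-]//].
    by exists y.
  have g'c : continuous g'.
    move=> y U /nbhs_agree-/(_ R)[m mU]; apply/(nbhs_agree R).
    exists m => z yz; apply: mU; have [_ g'd] := g'iso.
    by rewrite /agree -(cantor_dist_lt R) g'd cantor_dist_lt.
  apply: measurable_open; apply: open_comp => [z _|]; first exact: g'c.
  exact: (open_cylinder R).
rewrite /cyl_prob -(Kiso giso t x mv) -(Kiso g'iso t (g x) mg) gv gx.
by [].
Qed.

Lemma cyl_prob_stay t n (v : n.-tuple bool) x :
  agree n x (ext v) -> cyl_prob t v x = stay n t.
Proof.
rewrite -split_level_max => /eqP xv; apply: cyl_prob_split_level.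
apply/esym/eqP; rewrite xv split_level_max agree_sym.
by rewrite -eq_cprefix cprefixK.
Qed.

(** The sphere at level [k.+1] is the ball of depth [k] minus its child containing [x], which gives
    its mass. Each further subdivision halves the mass, since two sibling cylinders off [x] have the
    same level. *)
Lemma cyl_prob_leave t n k (v : n.-tuple bool) x : (k < n)%N ->
  split_level x v = k.+1 ->
  cyl_prob t v x = 2 ^- (n - k.+1) * (stay k t - stay k.+1 t).
Proof.
elim: n v => [//|n IH] v; rewrite ltnS leq_eqVlt => /predU1P[kn|kn] xv.
  rewrite -kn subnn expr0 invr1 mul1r in v xv *.
  have := cyl_prob_children t k x x.
  rewrite (@cyl_prob_stay _ _ (cprefix k x)); last first.
    by rewrite agree_sym -eq_cprefix cprefixK.
  rewrite (@cyl_prob_stay _ _ (cprefix k.+1 x)); last first.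
    by rewrite agree_sym -eq_cprefix cprefixK.
  move=> ->; rewrite addrC addKr; apply: cyl_prob_split_level.
  rewrite xv; apply/esym/eqP; rewrite split_level_cprefixE// agree_flip/=.
  by rewrite /flip eqxx; case: (x k).
pose y := ext v; have yv : cprefix n.+1 y = v by exact: cprefixK.
have := eqxx k.+1; rewrite -{1}xv -yv split_level_cprefixE 1?ltnW//.
move=> /andP[xy nxy].
have := cyl_prob_children t n y x.
rewrite yv (@cyl_prob_split_level _ _ (cprefix n.+1 (flip n y)) v x x); last first.
  apply/eqP; rewrite xv split_level_cprefixE 1?ltnW//; apply/andP; split.
    by apply: agree_trans xy _; apply: agree_le (agree_flip n y); exact: ltnW.
  by rewrite /flip (ltn_eqF kn) addbF.
rewrite IH//; last by apply/eqP; rewrite split_level_cprefixE// xy.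
rewrite subSn// exprS invfM -mulrA => ->.
by rewrite -mulr2n -[X in _ = _ * X]mulr_natl mulKf.
Qed.

Lemma stay0 t : stay 0 t = 1.
Proof.
rewrite /stay /cyl_prob (_ : cylinder _ = setT) ?K1//.
by apply/seteqP; split => // x _; apply/cylinder_cprefix/agreeP.
Qed.

Lemma stayS_le n t : stay n.+1 t <= stay n t.
Proof.
rewrite /stay (cyl_prob_children t n zeros zeros) lerDl; exact: cyl_prob_ge0.
Qed.

Lemma stay_le1 n t : stay n t <= 1.
Proof.
by elim: n => [|n IH]; [rewrite stay0|exact: le_trans (stayS_le n t) IH].
Qed.

Lemma level_avgB n (h : n.-tuple bool -> R) k x c : (0 < k <= n)%N ->
  level_avg h k x - c =
  2 ^- (n - k) * \sum_(v : n.-tuple bool | split_level x v == k) (h v - c).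
Proof.
case: k => [//|k] /= kn; rewrite /level_avg sumrB mulrBr sumr_const.
rewrite card_split_level// -[c *+ _]mulr_natl natrX mulKf//.
Qed.

(** The law of the prefix is grouped by spheres around [x]. Divided by [t], the coefficients tend to
    the jump rates, which yields the form of the operator. *)
Lemma semigroup_level t n (h : n.-tuple bool -> R) x :
  semigroup K t (h \o cprefix n) x - h (cprefix n x) =
  \sum_(1 <= k < n.+1) (stay k.-1 t - stay k t) *
    (level_avg h k x - h (cprefix n x)).
Proof.
set c := h (cprefix n x).
transitivity (\sum_(v : n.-tuple bool) (h v - c) * cyl_prob t v x).
  rewrite semigroup_sum -[X in _ - X]mulr1 -(sum_cyl_prob t n x) mulr_sumr.
  by rewrite -sumrB; apply: eq_bigr => v _; rewrite mulrBl.
transitivity (\sum_(1 <= k < n.+1) \sum_(v : n.-tuple bool | split_level x v == k)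
    (h v - c) * cyl_prob t v x); last first.
  apply: eq_big_nat => -[//|k] /= kn.
  rewrite level_avgB// mulrA mulr_sumr; apply: eq_bigr => v /eqP xv.
  by rewrite (cyl_prob_leave t (kn : (k < n)%N) xv) mulrC [_ * 2 ^- _]mulrC.
rewrite (exchange_big_dep xpredT)//=; apply: eq_bigr => v _.
under eq_bigl do rewrite eq_sym.
(* The only word whose level is outside the range is the prefix of [x] itself, where the difference
   vanishes. *)
rewrite big_nat1_eq; case: ifPn => // nv; rewrite (_ : h v = c) ?subrr ?mul0r//.
congr h; have : split_level x v == n.+1.
  by move: nv; rewrite /= -leqNgt eqn_leq split_level_le.
by rewrite split_level_max -eq_cprefix cprefixK => /eqP <-.
Qed.

Hypothesis Ktrans : transition_function K.

Lemma cyl_prob_extr t n (v : n.-tuple bool) x :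
  cyl_prob t v (ext (cprefix n x)) = cyl_prob t v x.
Proof. exact/cyl_prob_split_level/split_level_extl. Qed.

(** Since [cyl_prob] sees only the prefix of the starting point, the first [n] coordinates form a
    finite Markov chain and the Chapman-Kolmogorov integral becomes a finite sum. *)
Lemma cyl_prob_add s t n (v : n.-tuple bool) x :
  cyl_prob (s%:num + t%:num)%:nng v x =
  \sum_(w : n.-tuple bool) cyl_prob t v (ext w) * cyl_prob s w x.
Proof.
rewrite -(semigroup_sum s (fun w : n.-tuple bool => cyl_prob t v (ext w)) x).
rewrite /cyl_prob Ktrans.2; last exact: (measurable_cylinder R).
rewrite /semigroup /Rintegral; congr fine; apply: eq_integral => y _.
by rewrite /= -/(cyl_prob t v _) cyl_prob_extr -cyl_probE.
Qed.

Lemma semigroup_cylindric t n (h : n.-tuple bool -> R) :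
  semigroup K t (h \o cprefix n) =
  (fun w => \sum_v h v * cyl_prob t v (ext w)) \o cprefix n.
Proof.
apply/funext => x; rewrite semigroup_sum /=; apply: eq_bigr => v _.
by rewrite cyl_prob_extr.
Qed.

Lemma semigroup_add s t n (h : n.-tuple bool -> R) x :
  semigroup K (s%:num + t%:num)%:nng (h \o cprefix n) x =
  semigroup K s (semigroup K t (h \o cprefix n)) x.
Proof.
rewrite (semigroup_cylindric t) !semigroup_sum.
under eq_bigr do rewrite cyl_prob_add mulr_sumr.
rewrite exchange_big; apply: eq_bigr => w _ /=.
by rewrite mulr_suml; apply: eq_bigr => v _; rewrite mulrA.
Qed.

End kernel.

(** * Derivatives at time 0 *)

(** Cauchy's functional equation: nonnegativity makes [b] monotone, and [t] is enclosed between
    consecutive multiples of [1 / n.+1], where [b] is known. *)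
Lemma additive_ge0_linear (R : realType) (b : R -> R) :
  (forall s t, 0 < s -> 0 < t -> b (s + t) = b s + b t) ->
  (forall t, 0 < t -> 0 <= b t) ->
  forall t, 0 < t -> b t = t * b 1.
Proof.
move=> bD b0 t t0.
have bM n s : 0 < s -> b (n.+1%:R * s) = n.+1%:R * b s.
  move=> s0; elim: n => [|n IH]; first by rewrite !mul1r.
  by rewrite -natr1 mulrDl mul1r bD ?mulr_gt0// IH [in RHS]mulrDl mul1r.
have bmono s s' : 0 < s -> s <= s' -> b s <= b s'.
  move=> s0; rewrite le_eqVlt => /predU1P[->//|ss'].
  by rewrite -(subrKC s s') bD ?subr_gt0// lerDl b0 ?subr_gt0.
have b1 : 0 <= b 1 by exact: b0.
have bV n m : b (m.+1%:R * n.+1%:R^-1) = m.+1%:R / n.+1%:R * b 1.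
  rewrite bM ?invr_gt0//; have := bM n n.+1%:R^-1.
  rewrite divff ?pnatr_eq0// invr_gt0 ltr0n => ->//.
  by rewrite -mulrA mulKf ?pnatr_eq0.
have key n : `|b t - t * b 1| <= b 1 / n.+1%:R.
  have Nt0 : 0 <= t * n.+1%:R by rewrite mulr_ge0 ?ltW.
  have /andP[] := truncn_itv Nt0.
  set m := Num.truncn _; rewrite -ler_pdivrMr// -ltr_pdivlMr// => mt tm.
  have u : b t <= m.+1%:R / n.+1%:R * b 1 by rewrite -bV bmono// ltW.
  have l : m%:R / n.+1%:R * b 1 <= b t.
    case: m mt {tm u} => [_|m mt]; first by rewrite !mul0r b0.
    by rewrite -bV bmono// divr_gt0.
  have tl : m%:R / n.+1%:R * b 1 <= t * b 1 by rewrite ler_wpM2r.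
  have tu : t * b 1 <= m.+1%:R / n.+1%:R * b 1 by rewrite ler_wpM2r// ltW.
  have e : m.+1%:R / n.+1%:R * b 1 = m%:R / n.+1%:R * b 1 + b 1 / n.+1%:R.
    by rewrite -[m.+1%:R]natr1 !mulrDl mul1r [n.+1%:R^-1 * _]mulrC.
  move: u l tl tu; rewrite e ler_distlC.
  move: (m%:R / n.+1%:R * b 1) (b 1 / n.+1%:R) (t * b 1) (b t) => A B T S u l tl tu.
  by apply/andP; split; lra.
apply/eqP; rewrite -subr_eq0 -normr_le0; apply/ler_addgt0Pr => e e0.
rewrite add0r; apply: le_trans (key (Num.truncn (b 1 / e))) _.
rewrite ler_pdivrMr// mulrC -ler_pdivrMr//.
by apply/ltW/truncnS_gt.
Qed.

Lemma clipE (R : realType) (t : R) : 0 <= t -> (clip t)%:num = t.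
Proof. by move=> t0; apply/max_idPl. Qed.

Lemma clip_num (R : realType) (t : {nonneg R}) : clip t%:num = t.
Proof. by apply/val_inj; rewrite /= ; apply/max_idPl. Qed.

Lemma clipD (R : realType) (s t : R) : 0 <= s -> 0 <= t ->
  clip (s + t) = ((clip s)%:num + (clip t)%:num)%:nng.
Proof.
by move=> s0 t0; apply/val_inj; rewrite /= -!/(clip _)%:num !clipE ?addr_ge0.
Qed.

Lemma near0_gt0 (R : realType) (Q : R -> Prop) :
  (\forall t \near 0^'+, Q t) <-> exists2 d, 0 < d & forall t, 0 < t -> t < d -> Q t.
Proof.
split=> [|[d d0 dQ]].
  move=> [d /= d0 dQ]; exists d => // t t0 td; apply: dQ => //=.
  by rewrite sub0r normrN gtr0_norm.
exists d => //= t /=; rewrite sub0r normrN => td t0; apply: (dQ _ t0).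
by rewrite -(gtr0_norm t0).
Qed.

Lemma multiplicative_derivative (R : realType) (u : {nonneg R} -> R) :
  (forall s t, u (s%:num + t%:num)%:nng = u s * u t) ->
  (forall t, u t <= 1) ->
  u (clip t) @[t --> 0^'+] --> (1 : R) ->
  exists2 m : R, 0 <= m & (1 - u (clip t)) / t @[t --> 0^'+] --> m.
Proof.
move=> uD u1 uc.
(* Positivity holds near 0 by the limit, and any other value is a power of a value near 0; the
   logarithm is then defined. *)
have ugt0 t : 0 < t -> 0 < u (clip t).
  move=> t0.
  have /near0_gt0[d d0 ud] : \forall s \near 0^'+, 0 < u (clip s).
    by apply: (cvgr_gt _ uc).
  pose n := Num.truncn (t / d).
  have tn : t / n.+1%:R < d.
    by rewrite ltr_pdivrMr// mulrC -ltr_pdivrMr// truncnS_gt.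
  have s0 : 0 < t / n.+1%:R by rewrite divr_gt0.
  have upow k : u (clip (k.+1%:R * (t / n.+1%:R))) = u (clip (t / n.+1%:R)) ^+ k.+1.
    elim: k => [|k IH]; first by rewrite mul1r.
    by rewrite -[k.+2%:R]natr1 mulrDl mul1r clipD ?mulr_ge0 ?ltW// uD IH -exprSr.
  rewrite -(divfK (_ : n.+1%:R != 0) t) ?pnatr_eq0// mulrC upow exprn_gt0//.
  exact: ud.
pose b t := - ln (u (clip t)).
have bD s t : 0 < s -> 0 < t -> b (s + t) = b s + b t.
  by move=> s0 t0; rewrite /b clipD ?ltW// uD lnM ?posrE ?ugt0// opprD.
have b0 t : 0 < t -> 0 <= b t.
  by move=> t0; rewrite /b oppr_ge0 ln_le0.
have bl := additive_ge0_linear bD b0.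
exists (b 1); first exact: b0.
have b10 := b0 _ ltr01; set m := b 1 in b10 bl *.
have uE t : 0 < t -> u (clip t) = expR (- (t * m)).
  by move=> t0; rewrite -bl// /b opprK lnK// posrE ugt0.
apply/cvgrPdist_le => e e0; apply/near0_gt0.
(* The error is at most [m ^+ 2 * t]; adding 1 covers [m = 0]. Both bounds follow from
   [1 + y <= expR y] at [y = t * m] and at its opposite. *)
exists (e / (m ^+ 2 + 1)) => [|t t0]; first by rewrite divr_gt0// ltr_wpDl// sqr_ge0.
rewrite ltr_pdivlMr ?ltr_wpDl ?sqr_ge0// => te.
have tm0 : 0 <= t * m by rewrite mulr_ge0// ltW.
have l := expR_ge1Dx (- (t * m)); have r := expR_ge1Dx (t * m).
have p := expR_gt0 (- (t * m)).
have q : expR (- (t * m)) * expR (t * m) = 1 by rewrite -expRD addNr expR0.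
rewrite uE//; set x := expR _ in l p q *.
have x1 : x * (1 + t * m) <= 1 by rewrite -[leRHS]q ler_pM2l.
have ub : (1 - x) / t <= m by rewrite ler_pdivrMr//; lra.
have lb : m - m ^+ 2 * t <= (1 - x) / t.
  rewrite ler_pdivlMr//.
  have : x <= 1 - t * m + (t * m) ^+ 2 by nra.
  by rewrite exprMn; lra.
rewrite ger0_norm ?subr_ge0//.
have : m ^+ 2 * t <= e by nra.
lra.
Qed.

Section rates.
Variables (R : realType) (K : {nonneg R} -> R.-pker C ~> C).
Hypothesis Kiso : isometry_invariant K.
Hypothesis Ktrans : transition_function K.
Hypothesis Kcont : stochastically_continuous K.
Implicit Types t s : {nonneg R}.

(* The eigenvalue on [1_[w0] - 1_[w1]] for a word [w] of length [k]. *)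
Definition haar_eigenvalue k t : R := 2 * stay K k.+1 t - stay K k t.

(** For siblings [a] and [b] the function [h] is an eigenfunction: its image at [a] is
    [stay k.+1 - (stay k - stay k.+1)], opposite at [b]. The semigroup law evaluated at [zeros] then
    makes the eigenvalue multiplicative. *)
Lemma haar_eigenvalue_add k s t :
  haar_eigenvalue k (s%:num + t%:num)%:nng =
  haar_eigenvalue k s * haar_eigenvalue k t.
Proof.
pose a : k.+1.-tuple bool := cprefix k.+1 zeros.
pose b : k.+1.-tuple bool := cprefix k.+1 (flip k zeros).
have ab : b != a by rewrite eq_cprefix agreeS /flip eqxx/= andbF.
pose h (v : k.+1.-tuple bool) : R := (v == a)%:R - (v == b)%:R.
have levab : split_level (ext a) b = k.+1.
  by apply/eqP; rewrite split_level_extl split_level_cprefixE// agree_flip /flip eqxx.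
have levba : split_level (ext b) a = k.+1.
  apply/eqP; rewrite split_level_extl split_level_cprefixE// agree_sym agree_flip.
  by rewrite /flip eqxx.
have sumh (F : k.+1.-tuple bool -> R) : \sum_v h v * F v = F a - F b.
  under eq_bigr do rewrite mulrBl; rewrite sumrB; congr (_ - _).
    by rewrite (bigD1 a)//= eqxx mul1r big1 ?addr0// => v /negPf ->; rewrite mul0r.
  by rewrite (bigD1 b)//= eqxx mul1r big1 ?addr0// => v /negPf ->; rewrite mul0r.
have leave r (v w : k.+1.-tuple bool) : split_level (ext v) w = k.+1 ->
    cyl_prob K r w (ext v) = stay K k r - stay K k.+1 r.
  by move=> vw; rewrite (cyl_prob_leave Kiso r (ltnSn k) vw) subnn invr1 mul1r.
have eig r (w : k.+1.-tuple bool) : \sum_v h v * cyl_prob K r v (ext w) =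
    haar_eigenvalue k r * h w.
  rewrite sumh /h /haar_eigenvalue; have [->|wa] := eqVneq w a.
    rewrite (leave r a b levab) (cyl_prob_stay Kiso) ?agree_refl//.
    by rewrite (eq_sym a b) (negPf ab) /=; lra.
  have [->|wb] := eqVneq w b.
    by rewrite (leave r b a levba) (cyl_prob_stay Kiso) ?agree_refl//=; lra.
  (* Seen from any other word, [a] and [b] have the same level, so their contributions cancel. *)
  rewrite subrr mulr0; apply/eqP; rewrite subr_eq0; apply/eqP.
  apply: (cyl_prob_split_level Kiso); apply: split_level_congr => j.
  rewrite leq_eqVlt => /predU1P[->|jk].
    rewrite -!eq_cprefix !cprefixK (negPf wa).
    by rewrite (negPf wb).
  rewrite !agree_cprefix ?(ltnW jk)//; apply/idP/idP => /agree_trans; apply.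
    exact: agree_le (agree_flip k zeros).
  by rewrite agree_sym; exact: agree_le (agree_flip k zeros).
have := semigroup_add Kiso Ktrans s t h zeros.
rewrite (semigroup_cylindric Kiso (s%:num + t%:num)%:nng) /= eig /h eqxx.
rewrite eq_sym (negPf ab) subr0 mulr1 => ->.
rewrite (semigroup_cylindric Kiso t) semigroup_sum.
under eq_bigr do rewrite eig -mulrA.
rewrite -mulr_sumr mulrC; congr (_ * _).
have := eig s a; rewrite /h eqxx eq_sym (negPf ab) subr0 mulr1 => <-.
by apply: eq_bigr => v _; rewrite (cyl_prob_extr Kiso).
Qed.

Lemma stay_cvg n : stay K n (clip t) @[t --> 0^'+] --> (1 : R).
Proof.
apply: fine_cvg; apply: Kcont; first exact: (open_cylinder R).
by apply/cylinder_cprefix; exact: agree_refl.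
Qed.

(** Induction from [1 - haar_eigenvalue n = 2 * (1 - stay n.+1) - (1 - stay n)], solved for the term
    with [stay n.+1]. *)
Lemma stay_derivative n :
  exists a : R, (1 - stay K n (clip t)) / t @[t --> 0^'+] --> a.
Proof.
elim: n => [|n [a na]].
  by exists 0; under eq_fun do rewrite stay0 subrr mul0r; exact: cvg_cst.
have [m _ mn] : exists2 m : R, 0 <= m &
    (1 - haar_eigenvalue n (clip t)) / t @[t --> 0^'+] --> m.
  apply: multiplicative_derivative.
  - exact: haar_eigenvalue_add.
  - move=> t; rewrite /haar_eigenvalue.
    by have := stayS_le K n t; have := stay_le1 K n.+1 t; lra.
  - have -> : (1 : R) = 2 * 1 - 1 by lra.
    by apply: cvgB; [apply: cvgMr; exact: stay_cvg|exact: stay_cvg].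
exists ((m + a) / 2).
rewrite (_ : (fun t : R => _) = (fun t : R =>
    ((1 - haar_eigenvalue n (clip t)) / t + (1 - stay K n (clip t)) / t) / 2)).
  by apply: cvgM; [exact: cvgD|exact: cvg_cst].
by apply/funext => t; rewrite -mulrDl mulrAC /haar_eigenvalue; congr (_ / _); lra.
Qed.

End rates.

(** * Confinement *)

Definition time0 (R : realType) : {nonneg R} := 0%:nng.

Section paths.
Variables (R : realType) (K : {nonneg R} -> R.-pker C ~> C).
Variable P : C -> probability (cadlag_path R) R.
Hypothesis markov : markov_family K P.
Hypothesis Kiso : isometry_invariant K.
Implicit Types (t T : {nonneg R}) (w : cadlag_path R).

Let Ktrans : transition_function K. Proof. by case: markov. Qed.

Lemma past_coord t T (B : set C) : t <= T -> measurable B ->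
  past T [set w : cadlag_path R | B (w t)].
Proof. by move=> tT mB; apply: sub_sigma_algebra; exists t => //; exists B. Qed.

Lemma measurable_past T (E : set (cadlag_path R)) : past T E -> measurable E.
Proof.
apply: sub_smallest2r; first exact: smallest_sigma_algebra.
by move=> A /= [t _ tA]; exists t.
Qed.

Lemma measurable_coord t (B : set C) : measurable B ->
  measurable [set w : cadlag_path R | B (w t)].
Proof. by move=> mB; apply: (@measurable_past t); exact: past_coord. Qed.

(** The Markov property at time 0, applied to the almost sure event [E] that the path starts at [x];
    intersecting with [E] does not change probabilities. *)
Lemma coord_law x t B : measurable B ->
  P x [set w : cadlag_path R | B (w t)] = K t x B.
Proof.
move=> mB; have [_ P0 PM] := markov.
pose E : set (cadlag_path R) := [set w | [set x] (w (time0 R))].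
have mE : measurable E by apply: measurable_coord; exact: (measurable_point).
have PE : P x E = 1%E := P0 x.
have PEC : P x (~` E) = 0%E by rewrite probability_setC// PE subee.
have := PM x (time0 R) t B E mB (past_coord (lexx _) (measurable_point x)).
have -> : ((time0 R)%:num + t%:num)%:nng = t :> {nonneg R}.
  by apply/val_inj; rewrite /= add0r.
rewrite (eq_integral (cst (K t x B))); last first.
  by move=> w; rewrite inE /E/= => ->.
rewrite integral_cst//= PE mule1 => <-.
have mF := measurable_coord t mB.
apply/eqP; rewrite eq_le; apply/andP; split; last first.
  by apply: le_measure; rewrite ?inE//; exact: measurableI.
rewrite -[X in P x X](setUIDK _ E) setIC.
rewrite (le_trans (measureU2 _ _ _))//; [exact: measurableI|exact: measurableD|].
rewrite -[leRHS]adde0 leeD2l// -PEC le_measure ?inE//.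
- exact: measurableD.
- exact: measurableC.
Qed.

Definition exit_between n (v : n.-tuple bool) (s t : {nonneg R}) :
    set (cadlag_path R) :=
  [set w | cylinder v (w s)] `&`
  [set w | (~` cylinder v) (w (s%:num + t%:num)%:nng)].

Lemma measurable_exit_between n (v : n.-tuple bool) s t :
  measurable (exit_between v s t).
Proof.
have mv := measurable_cylinder R v.
by apply: measurableI; apply: measurable_coord => //; exact: measurableC.
Qed.

(** Wherever the path is inside the cylinder at time [s], it is outside after a further [t] with the
    same probability [1 - stay K n t]. *)
Lemma exit_between_le x n (v : n.-tuple bool) (s t : {nonneg R}) :
  (P x (exit_between v s t) <= (1 - stay K n t)%:E)%E.
Proof.
have [_ _ PM] := markov; have mv := measurable_cylinder R v.
have -> := PM x s t _ _ (measurableC mv) (past_coord (lexx s) mv).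
rewrite (eq_integral (cst (1 - stay K n t)%:E)); last first.
  move=> w; rewrite inE /= => /cylinderE wv.
  by rewrite cyl_probC (cyl_prob_stay Kiso).
have mE := measurable_coord s mv.
rewrite integral_cst//= -[leRHS]mule1 lee_wpmul2l//.
  by rewrite lee_fin subr_ge0 stay_le1.
exact: probability_le1.
Qed.

Definition grid_exit n (v : n.-tuple bool) (s : R) (j : nat) :
    set (cadlag_path R) :=
  [set w | exists2 i : nat, (i <= j)%N & ~ cylinder v (w (clip (i%:R * s)))].

Lemma measurable_grid_exit n (v : n.-tuple bool) s j :
  measurable (grid_exit v s j).
Proof.
have -> : grid_exit v s j = \bigcup_(i < j.+1)
    [set w : cadlag_path R | (~` cylinder v) (w (clip (i%:R * s)))].
  by apply/seteqP; split => w [i ij wv]; exists i.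
apply: bigcup_measurable => i _; apply: measurable_coord; apply: measurableC.
exact: (measurable_cylinder R).
Qed.

(** Union bound: being outside at a grid time for the first time requires a crossing during the last
    step, and each step costs at most [1 - stay K n (clip s)]. *)
Lemma grid_exit_le n (v : n.-tuple bool) x s j : 0 <= s -> cylinder v x ->
  (P x (grid_exit v s j) <= (j%:R * (1 - stay K n (clip s)))%R%:E)%E.
Proof.
move=> s0 vx; elim: j => [|j IH].
  rewrite mul0r; have -> : grid_exit v s 0 =
      [set w : cadlag_path R | (~` cylinder v) (w (time0 R))].
    have c0 : clip 0 = time0 R :> {nonneg R} by apply/val_inj; rewrite /= maxxx.
    apply/seteqP; split => w /=; last by move=> wv; exists 0%N; rewrite ?mul0r ?c0.
    by case=> i; rewrite leqn0 => /eqP ->; rewrite mul0r c0.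
  have mv := measurable_cylinder R v.
  have mvC := measurableC mv; rewrite coord_law// (Ktrans.1 _ _ mvC).
  by rewrite diracE memNset//= => /(_ vx).
have js0 : 0 <= j%:R * s by rewrite mulr_ge0.
apply: (@le_trans _ _ (P x (grid_exit v s j `|`
  exit_between v (clip (j%:R * s)) (clip s)))).
  apply: le_measure; rewrite ?inE; [exact: measurable_grid_exit| |].
    by apply: measurableU; [exact: measurable_grid_exit|exact: measurable_exit_between].
  move=> w [i]; rewrite leq_eqVlt => /predU1P[->|ij] wv; last by left; exists i.
  have [wj|wj] := pselect (cylinder v (w (clip (j%:R * s)))); last by left; exists j.
  right; split => //=; rewrite -clipD//.
  by rewrite -[X in _ + X]mul1r -mulrDl natr1.
rewrite (le_trans (measureU2 _ _ _))//.
- exact: measurable_grid_exit.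
- exact: measurable_exit_between.
- by rewrite -natr1 mulrDl mul1r EFinD leeD// exit_between_le.
Qed.

End paths.

Section confinement.
Variables (R : realType) (K : {nonneg R} -> R.-pker C ~> C).
Variable P : C -> probability (cadlag_path R) R.
Hypothesis markov : markov_family K P.
Hypothesis Kiso : isometry_invariant K.
Implicit Types (t T : {nonneg R}) (w : cadlag_path R).

Lemma dyadic_cvg (T : R) : 0 < T -> (T / 2 ^+ m) @[m --> \oo] --> (0 : R).
Proof.
move=> T0; rewrite -[X in _ --> X](mulr0 T); apply: cvgMr.
under eq_fun do rewrite -exprVn.
by apply: cvg_expr; rewrite ger0_norm ?invf_lt1 ?ltr1n.
Qed.

Lemma grid_cvg n (a T : R) : 0 < T ->
  (1 - stay K n (clip t)) / t @[t --> 0^'+] --> a ->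
  (2 ^ m)%:R * (1 - stay K n (clip (T / 2 ^+ m))) @[m --> \oo] --> T * a.
Proof.
move=> T0 /cvg_at_rightP/(_ (fun m => T / 2 ^+ m)) na.
have {}na := na (conj (fun m => divr_gt0 T0 (exprn_gt0 m (ltr0Sn R 1))) (dyadic_cvg T0)).
rewrite (_ : (fun m : nat => _) = (fun m => T *
   ((1 - stay K n (clip (T / 2 ^+ m))) / (T / 2 ^+ m)))).
  exact: cvgMr.
apply/funext => m; set u := 1 - stay _ _ _.
rewrite natrX invf_div [RHS]mulrCA [T * _]mulrC divfK ?gt_eqF//.
by rewrite mulrC.
Qed.

(** Cylinders are also closed, so by right continuity a path outside at time [t < T] remains outside
    just after [t], where a fine dyadic grid has a point. The time [T] belongs to every grid. *)
Lemma unconfinedE n (v : n.-tuple bool) T : 0 < T%:num ->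
  ~` confined v T =
  \bigcup_m @grid_exit R n v (T%:num / 2 ^+ m) (2 ^ m).
Proof.
move=> T0; apply/seteqP; split => [w /= /existsNP[t /not_implyP[tT wt]]|w [m _]].
  have [tE|tT'] := eqVneq t T.
    rewrite tE in wt; exists 0%N => //; exists 1%N => //.
    by rewrite expr0 divr1 mul1r clip_num.
  have {tT'} tT' : t%:num < T%:num.
    by rewrite lt_neqAle; apply/andP; split => //; apply: contra tT' => /eqP/val_inj ->.
  have [rc _] := path_cadlag w t.
  have [d d0 dw] : exists2 d, 0 < d & forall s, t%:num < s -> s < t%:num + d ->
      ~ cylinder v (w (clip s)).
    have wtv : nbhs (w t) (~` cylinder v).
      apply/(nbhs_agree R); exists n => y wty /cylinderE yv; apply: wt.
      by apply/cylinderE; exact: agree_trans wty yv.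
    have [d /= d0 dw] := rc _ wtv; exists d => // s ts std; apply: dw => //=.
    by rewrite ltr0_norm ?subr_lt0// opprB ltrBlDl.
  have /cvgr0_norm_lt/(_ _ d0)[m _ /(_ m (leqnn m)) /= md] := dyadic_cvg T0.
  have s0 : 0 < T%:num / 2 ^+ m by rewrite divr_gt0 ?exprn_gt0.
  rewrite gtr0_norm// in md.
  have ts0 : 0 <= t%:num / (T%:num / 2 ^+ m) by rewrite divr_ge0// ltW.
  (* The first grid point strictly after [t]; its index is at most [2 ^ m] because [t < T]. *)
  exists m => //; exists (Num.truncn (t%:num / (T%:num / 2 ^+ m))).+1.
    have /andP[+ _] := truncn_itv ts0 => le.
    rewrite -(ltr_nat R) (le_lt_trans le)// natrX ltr_pdivrMr//.
    by rewrite mulrC divfK// gt_eqF// exprn_gt0.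
  have /andP[] := truncn_itv ts0; rewrite ler_pdivlMr// ltr_pdivrMr// => l u.
  apply: dw => //; apply: le_lt_trans (_ : _ <= t%:num + T%:num / 2 ^+ m) _.
    by rewrite -natr1 mulrDl mul1r lerD2r.
  by rewrite ltrD2l.
case=> i im wi /(_ (clip (i%:R * (T%:num / 2 ^+ m)))) cw; apply: wi; apply: cw.
rewrite -num_le /= -/((clip _)%:num) clipE; last by rewrite mulr_ge0// divr_ge0.
rewrite mulrA ler_pdivrMr ?exprn_gt0// mulrC ler_pM2l//.
by rewrite -natrX ler_nat.
Qed.

(** The events [grid_exit] increase with the dyadic level, and [grid_cvg] bounds each by [T * a];
    continuity from below passes the bound to their union. Countability of the union gives
    measurability. *)
Lemma unconfined_le n (v : n.-tuple bool) T (a : R) x :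
  (1 - stay K n (clip t)) / t @[t --> 0^'+] --> a ->
  0 < T%:num -> cylinder v x ->
  measurable (confined v T) /\
  (P x (~` confined v T) <= (T%:num * a)%:E)%E.
Proof.
move=> na T0 vx; pose F m := @grid_exit R n v (T%:num / 2 ^+ m) (2 ^ m).
have mF m : measurable (F m) by exact: measurable_grid_exit.
have mUF : measurable (\bigcup_m F m) by exact: bigcupT_measurable.
split; first by rewrite -[confined _ _]setCK unconfinedE//; exact: measurableC.
rewrite unconfinedE//.
have Fhomo : {homo F : m n / (m <= n)%N >-> (m <= n)%O}.
  apply: homo_leq => [A|A B D|m]; [exact: lexx|exact: le_trans|].
  (* Refining the grid doubles the index of a point. *)
  apply/subsetPset => w [i im wi]; exists (2 * i)%N.
    by rewrite expnS leq_mul2l im.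
  rewrite natrM; have -> : 2%:R * i%:R * (T%:num / 2 ^+ m.+1) = i%:R * (T%:num / 2 ^+ m).
    by rewrite exprS invfM; field.
  by [].
have Fle m k : (m <= k)%N ->
    (P x (F m) <= ((2 ^ k)%:R * (1 - stay K n (clip (T%:num / 2 ^+ k))))%R%:E)%E.
  move=> mk; apply: (@le_trans _ _ (P x (F k))).
    by apply: le_measure; rewrite ?inE//; apply/subsetPset/Fhomo.
  by apply: (grid_exit_le markov Kiso) => //; rewrite divr_ge0.
have Fa m : (P x (F m) <= (T%:num * a)%:E)%E.
  rewrite -[P x (F m)]fineK ?fin_num_measure// lee_fin.
  apply: (ler_cvg_to (cvg_cst _) (grid_cvg T0 na)).
  exists m => // k /= mk.
  by rewrite -lee_fin fineK ?fin_num_measure// Fle.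
have cF := nondecreasing_cvg_mu (mu := P x) mF mUF Fhomo.
rewrite -(cvg_lim _ cF)//; apply: lime_le.
  by apply/cvg_ex; eexists; exact: cF.
by apply: nearW => m; exact: Fa.
Qed.

End confinement.

(** * Self-similarity *)

Definition shift (x : C) : C := fun i => x i.+1.

Definition unshift (x : C) : C := fun i => if i is j.+1 then x j else false.

Lemma cantor_distE (R : realType) k (x y : C) : agree k x y -> x k != y k ->
  cantor_dist R x y = 3 ^- k.+1.
Proof.
move=> /agreeP xy xyk; rewrite /cantor_dist; case: pselect => [p|np].
  case: ex_minnP => m xym mle; suff -> : m = k by [].
  apply/eqP; rewrite eqn_leq mle//= leqNgt; apply/negP => mk.
  by move: xym; rewrite xy// eqxx.
by exfalso; apply: np; exists k.
Qed.

Lemma cantor_distxx (R : realType) (x : C) : cantor_dist R x x = 0.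
Proof.
by rewrite /cantor_dist; case: pselect => // p; exfalso; case: p => k; rewrite eqxx.
Qed.

Lemma first_difference (x y : C) : x <> y -> exists2 k, agree k x y & x k != y k.
Proof.
move=> xy; have [k kxy] : exists k, x k != y k.
  apply: contrapT => /forallNP e; apply: xy; apply/funext => i; apply/eqP.
  by rewrite -[_ == _]negbK; apply/negP/e.
have ex : exists k, x k != y k by exists k.
case: (ex_minnP ex) => m xym mle; exists m => //; apply/agreeP => i im.
apply/eqP; apply: contraTT im => /mle; rewrite -leqNgt//.
Qed.

Lemma shift_similarity (R : realType) : similarity R (cprefix 1 zeros) shift.
Proof.
have cyl0 (x : C) : cylinder (cprefix 1 zeros) x -> x 0%N = false.
  by move=> /cylinder_cprefix/agreeP/(_ 0%N erefl).
split.
  split => [//|y z /set_mem/cyl0 y0 /set_mem/cyl0 z0 yz|x _].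
    by apply/funext => -[|i]; [rewrite y0 z0|exact: (congr1 (fun u : C => u i) yz)].
  by exists (unshift x) => //; apply/cylinder_cprefix/agreeP => -[].
move=> y z /cyl0 y0 /cyl0 z0; have [->|/first_difference[[|k] yz nyz]] := pselect (y = z).
- by rewrite !cantor_distxx mulr0.
- by rewrite y0 z0 in nyz.
- rewrite (cantor_distE R yz nyz) (@cantor_distE _ k)//; last first.
    by apply/agreeP => i ik; exact: (agreeP _ _ _ yz).
  by rewrite expr1 [3 ^+ k.+2]exprS invfM mulVKf.
Qed.

Lemma shift_cylinder k :
  shift @` cylinder (cprefix k.+1 zeros) = cylinder (cprefix k zeros).
Proof.
apply/seteqP; split => [_ [x /cylinder_cprefix/agreeP x0 <-]|x /cylinder_cprefix/agreeP x0].
  by apply/cylinder_cprefix/agreeP => i ik; exact: (x0 i.+1).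
exists (unshift x) => //; apply/cylinder_cprefix/agreeP => -[//|i] ik.
exact: x0.
Qed.

Section rates.
Variables (R : realType) (K : {nonneg R} -> R.-pker C ~> C).
Variable P : C -> probability (cadlag_path R) R.
Hypothesis markov : markov_family K P.
Hypothesis Kiso : isometry_invariant K.
Implicit Types (t T : {nonneg R}) (w : cadlag_path R).

(** The difference [stay K 1 t - c] is the probability of having left the cylinder and being back at
    time [t]; it controls the loss when the event of ending in the smaller cylinder is restricted to
    confined paths. *)
Lemma confined_stay (eps1 : R) t k :
  (1 - stay K 1 (clip t)) / t @[t --> 0^'+] --> eps1 -> 0 < t%:num ->
  let v := cprefix 1 zeros in
  let c := fine (P zeros (confined v t)) in
  let N := fine (P zeros ([set w : cadlag_path R |
    cylinder (cprefix k.+1 zeros) (w t)] `&` confined v t)) in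
  [/\ 1 - t%:num * eps1 <= c, c <= stay K 1 t, 0 <= N, N <= c &
    stay K k.+1 t - (stay K 1 t - c) <= N <= stay K k.+1 t].
Proof.
move=> eps1_lim t0 v c N.
have vz : cylinder v zeros by apply/cylinder_cprefix; exact: agree_refl.
have [mc Pc] := unconfined_le markov Kiso eps1_lim t0 vz.
pose E : set (cadlag_path R) := [set w | cylinder (cprefix k.+1 zeros) (w t)].
pose A : set (cadlag_path R) := [set w | cylinder v (w t)].
have mE : measurable E := measurable_coord t (measurable_cylinder R _).
have mA : measurable A := measurable_coord t (measurable_cylinder R _).
have cA : confined v t `<=` A by move=> w /(_ t (lexx t)).
have EA : E `<=` A.
  move=> w /cylinder_cprefix h; apply/cylinder_cprefix.
  exact: agree_le h.
have fP B : measurable B -> P zeros B = (fine (P zeros B))%:E.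
  by move=> mB; rewrite fineK// fin_num_measure.
have PE : P zeros E = (stay K k.+1 t)%:E.
  by rewrite (coord_law markov) ?cyl_probE//; exact: (measurable_cylinder R).
have PA : P zeros A = (stay K 1 t)%:E.
  by rewrite (coord_law markov) ?cyl_probE//; exact: (measurable_cylinder R).
have mEc : measurable (E `&` confined v t) by exact: measurableI.
split.
- move: Pc; rewrite probability_setC// fP// -/c -EFinB lee_fin; lra.
- by rewrite -lee_fin -PA /c -fP// le_measure ?inE.
- by rewrite fine_ge0.
- by rewrite -lee_fin -!fP// le_measure ?inE.
- apply/andP; split; last first.
    by rewrite -lee_fin -PE -fP// le_measure ?inE.
  rewrite lerBlDr -lee_fin EFinD -PE EFinB -PA /N /c -!fP//.
  have -> : (P zeros A - P zeros (confined v t) = P zeros (A `\` confined v t))%E.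
    rewrite measureD// ?(setIidr cA)//.
    by apply: le_lt_trans (probability_le1 (P zeros) mA) _; rewrite ltry.
  apply: le_trans (measureU2 _ mEc _); last exact: measurableD.
  apply: le_measure; rewrite ?inE//.
    by apply: measurableU => //; exact: measurableD.
  move=> w Ew; have [cw|ncw] := pselect (confined v t w); first by left.
  by right; split => //; exact: EA.
Qed.

Lemma self_similar_stay (eps1 : R) :
  (1 - stay K 1 (clip t)) / t @[t --> 0^'+] --> eps1 -> self_similar P ->
  exists alpha : {posnum R}, forall k t, 0 < t%:num ->
  let v := cprefix 1 zeros in
  fine (P zeros ([set w : cadlag_path R |
    cylinder (cprefix k.+1 zeros) (w t)] `&` confined v t)) =
  stay K k (alpha%:num * t%:num)%:nng * fine (P zeros (confined v t)).
Proof.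
move=> eps1_lim /(_ 1%N isT)[alpha ss]; exists alpha => k t t0 v.
have vz : cylinder v zeros by apply/cylinder_cprefix; exact: agree_refl.
have [Q Qv Qss] := ss v zeros vz.
pose B (i : 'I_1) := cylinder (cprefix k.+1 zeros).
have mB (i : 'I_1) : measurable (B i) /\ B i `<=` cylinder v.
  split; first exact: (measurable_cylinder R).
  move=> x /cylinder_cprefix h; apply/cylinder_cprefix.
  exact: agree_le h.
have setE (D : set C) (s : {nonneg R}) : [set w : cadlag_path R | 'I_1 -> D (w s)] =
    [set w | D (w s)].
  by apply/seteqP; split => w /= h //; exact: (h ord0).
have : Q [set w | cylinder (cprefix k.+1 zeros) (w t)] =
    P (shift zeros) [set w | cylinder (cprefix k zeros) (w (alpha%:num * t%:num)%:nng)].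
  rewrite -(setE (cylinder (cprefix k.+1 zeros))).
  rewrite -(setE (cylinder (cprefix k zeros))) -(shift_cylinder k).
  exact: (Qss _ (shift_similarity R) 1%N (fun=> t) B isT mB).
have -> : shift zeros = zeros by [].
rewrite (coord_law markov); last exact: (measurable_cylinder R).
rewrite cyl_probE (Qv t t0); last first.
  by apply: past_coord => //; exact: (measurable_cylinder R).
set c := fine (P zeros (confined v t)); set N := fine _ => -[].
rewrite -/(stay K k _) => NE.
(* For [c = 0] the quotient carries no information, but [0 <= N <= c] still gives [N = 0]. *)
have [c0|c0] := eqVneq c 0; last by rewrite -NE divfK.
rewrite c0 mulr0; apply/eqP; rewrite eq_le.
by have [_ _ -> + _] := confined_stay k eps1_lim t0; rewrite -/N -/v -/c c0 => ->.
Qed.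

(** The quotient [(1 - N) / t] has two limits to compare: [N] differs from [stay k.+1] by o(t), and
    it factors as [stay k] at time [alpha * t] times [c]. *)
Lemma rate_recursion (eps : nat -> R) :
  (forall n, (1 - stay K n (clip t)) / t @[t --> 0^'+] --> eps n) ->
  self_similar P ->
  exists alpha : {posnum R}, forall k, eps k.+1 = eps 1%N + alpha%:num * eps k.
Proof.
move=> eps_lim Pss.
have [alpha Pa] := self_similar_stay (eps_lim 1%N) Pss.
exists alpha => k; have a0 : 0 < alpha%:num by [].
set a := alpha%:num in a0 *.
(* The limits [eps] being known to exist, one sequence of times decreasing to 0 suffices to identify
   them. *)
pose t m : R := 1 / 2 ^+ m.
have t0 m : 0 < t m by rewrite divr_gt0 ?exprn_gt0.
have tc : t m @[m --> \oo] --> (0 : R) := dyadic_cvg ltr01.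
have at0 m : 0 < a * t m by rewrite mulr_gt0.
have atc : a * t m @[m --> \oo] --> (0 : R).
  by rewrite -[X in _ --> X](mulr0 a); exact: cvgMr.
pose s j m := stay K j (clip (t m)).
have A j : (1 - s j m) / t m @[m --> \oo] --> eps j.
  by have /cvg_at_rightP/(_ t) := eps_lim j; apply.
pose b m := (1 - stay K k (clip (a * t m))) / (a * t m).
have B : b m @[m --> \oo] --> eps k.
  by have /cvg_at_rightP/(_ (fun m => a * t m)) := eps_lim k; apply.
pose c m := fine (P zeros (confined (cprefix 1 zeros) (clip (t m)))).
pose N m := fine (P zeros ([set w : cadlag_path R |
    cylinder (cprefix k.+1 zeros) (w (clip (t m)))] `&`
    confined (cprefix 1 zeros) (clip (t m)))).
have NE m : N m = (1 - a * t m * b m) * c m.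
  rewrite /N Pa; last by rewrite clipE// ltW.
  congr (_ * _).
  have -> : a * t m * b m = 1 - stay K k (clip (a * t m)).
    by rewrite /b mulrC divfK// gt_eqF.
  rewrite subKr; congr (stay K k _).
  by apply/val_inj; rewrite /= -/((clip _)%:num) !clipE// ltW.
have bounds m : [/\ 1 - t m * eps 1%N <= c m, c m <= s 1%N m &
    s k.+1 m - (s 1%N m - c m) <= N m <= s k.+1 m].
  have := confined_stay k (eps_lim 1%N) (t := clip (t m)).
  by rewrite (clipE (ltW (t0 m))) => /(_ (t0 m))[].
have D : (1 - c m) / t m @[m --> \oo] --> eps 1%N.
  apply: (squeeze_cvgr _ (A 1%N) (cvg_cst _)); apply: nearW => m.
  have [lc uc _] := bounds m; rewrite ler_pM2r ?invr_gt0// ler_pdivrMr//.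
  by apply/andP; split; lra.
have E1 : (1 - N m) / t m @[m --> \oo] --> eps k.+1.
  have U : (1 - s k.+1 m) / t m + ((1 - c m) / t m - (1 - s 1%N m) / t m)
      @[m --> \oo] --> eps k.+1 + (eps 1%N - eps 1%N).
    by apply: cvgD; [exact: A|apply: cvgB; [exact: D|exact: A]].
  rewrite subrr addr0 in U.
  apply: (squeeze_cvgr _ (A k.+1) U); apply: nearW => m.
  have [_ _ /andP[lN uN]] := bounds m.
  rewrite -mulrBl -mulrDl !ler_pM2r ?invr_gt0//.
  by apply/andP; split; lra.
have E2 : (1 - N m) / t m @[m --> \oo] --> eps 1%N + a * eps k.
  rewrite (_ : (fun m : nat => _) =
      (fun m => (1 - c m) / t m + (a * b m - a * b m * (((1 - c m) / t m) * t m)))).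
    rewrite -[X in _ --> _ + X]subr0 -[X in _ --> _ + (_ - X)](mulr0 (a * eps k)).
    apply: cvgD => //; have aB : a * b m @[m --> \oo] --> a * eps k by exact: cvgMr.
    apply: cvgB => //; apply: cvgM => //; rewrite -[X in _ --> X](mulr0 (eps 1%N)).
    exact: cvgM.
  apply/funext => m; rewrite NE; field.
  by rewrite gt_eqF.
exact: (cvg_unique _ E1 E2).
Qed.

Lemma geometric_rates (eps : nat -> R) :
  (forall n, (1 - stay K n (clip t)) / t @[t --> 0^'+] --> eps n) ->
  self_similar P ->
  exists gamma theta : R, [/\ 0 <= gamma, 0 <= theta &
    forall k, (0 < k)%N -> eps k - eps k.-1 = gamma * theta ^+ k].
Proof.
move=> eps_lim /(rate_recursion eps_lim)[alpha rec].
have eps0 : eps 0%N = 0.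
  apply: (cvg_unique _ (eps_lim 0%N)) => //=.
  by under eq_fun do rewrite stay0 subrr mul0r; exact: cvg_cst.
(* Subtracting consecutive recursions leaves [alpha] times the previous difference; the first
   difference is [eps 1], which must equal [gamma * theta]. *)
exists (eps 1%N / alpha%:num), alpha%:num; split => //.
  rewrite divr_ge0//; apply: (ler_cvg_to (cvg_cst 0) (eps_lim 1%N)).
  apply/near0_gt0; exists 1 => // t t0 _.
  by apply: divr_ge0; [rewrite subr_ge0 stay_le1|exact: ltW].
elim=> [//|[_ _|k /(_ isT) IH _]]; first by rewrite eps0 subr0 expr1 divfK.
rewrite /= in IH *; rewrite rec [X in _ - X]rec opprD addrACA subrr add0r.
by rewrite -mulrBr IH [in RHS]exprS mulrCA.
Qed.

End rates.

(** * The generator *)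

Section uniform.
Variable R : realType.
Implicit Types f g : {uniform C -> R}.

Lemma nbhs_uniform f (B : set {uniform C -> R}) : nbhs f B <->
  exists2 e : R, 0 < e & forall g, (forall x, `|f x - g x| < e) -> B g.
Proof.
split=> [/uniform_nbhs[E [+ EB]]|[e e0 eB]].
  rewrite -entourage_ballE => -[e /= e0 eE]; exists e => // g fg.
  by apply: EB => y _; apply: eE => /=; exact: fg.
apply/uniform_nbhs; exists [set xy : R * R | ball xy.1 e xy.2]; split.
  exact: (entourage_ball R (PosNum e0)).
by move=> g fg; apply: eB => x; exact: fg.
Qed.

Lemma closure_uniform (A : set ({uniform C -> R} * {uniform C -> R})) f g :
  closure A (f, g) <-> forall e : R, 0 < e -> exists f' g',
    A (f', g') /\ forall x, `|f x - f' x| < e /\ `|g x - g' x| < e.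
Proof.
split=> [Afg e e0|Afg B [[B1 B2] /= [nB1 nB2] B12]].
  have : nbhs ((f, g) : _ * _) [set fg : {uniform C -> R} * {uniform C -> R} |
      forall x, `|f x - fg.1 x| < e /\ `|g x - fg.2 x| < e].
    exists ([set f' | forall x, `|f x - f' x| < e], [set g' | forall x, `|g x - g' x| < e]).
      by split; apply/nbhs_uniform; exists e.
    by move=> [f' g'] /= [ff gg] x.
  by move=> /Afg[[f' g'] [Afg' fg']]; exists f', g'.
have /nbhs_uniform[e1 e10 eB1] := nB1; have /nbhs_uniform[e2 e20 eB2] := nB2.
have [] := Afg (Num.min e1 e2); first by rewrite lt_min e10.
move=> f' [g' [Afg' fg']]; exists (f', g'); split => //; apply: B12; split => /=.
  by apply: eB1 => x; have [+ _] := fg' x; rewrite lt_min => /andP[].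
by apply: eB2 => x; have [_] := fg' x; rewrite lt_min => /andP[].
Qed.

Lemma uniform_limit f : (forall e : R, 0 < e -> exists2 g : C -> R,
  continuous g & forall x, `|f x - g x| <= e) -> continuous (f : C -> R).
Proof.
move=> fapp x; apply/cvgrPdist_le => e e0.
have e30 : 0 < e / 3 by rewrite divr_gt0.
have [g gc fg] := fapp _ e30; have /cvgrPdist_le/(_ _ e30) := gc x.
apply: filterS => y gxy.
have := fg x; have := fg y; rewrite !ler_norml in gxy * => /andP[? ?] /andP[? ?].
by move/andP: gxy => [? ?]; apply/andP; split; lra.
Qed.

End uniform.

(* The system is injective: at a maximum of [|h|], a solution of the homogeneous
   equation satisfies [|h x| <= 0]. *)
Lemma dominant_system_solvable (R : realType) (T : finType) (b : T -> T -> R)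
  (u : T -> R) : (forall x y, 0 <= b x y) ->
  exists h : T -> R, forall x, h x - \sum_y b x y * (h y - h x) = u x.
Proof.
move=> b0.
pose n := #|T|.
(* Column [j] holds the equation at [enum_val j], since the unknown is a row vector multiplying from
   the left. *)
pose M : 'M[R]_n := \matrix_(i, j)
  ((i == j)%:R * (1 + \sum_y b (enum_val j) y) - b (enum_val j) (enum_val i)).
have ME (v : 'rV[R]_n) (h := fun x => v 0 (enum_rank x)) x :
    (v *m M) 0 (enum_rank x) = h x - \sum_y b x y * (h y - h x).
  rewrite mxE.
  under eq_bigr do rewrite mxE enum_rankK mulrBr.
  have diag c : \sum_j v 0 j * ((j == enum_rank x)%:R * c) = h x * c.
    rewrite (bigD1 (enum_rank x))//= eqxx mul1r big1 ?addr0// => j jx.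
    by rewrite (negPf jx) mul0r mulr0.
  rewrite sumrB diag; under [in RHS]eq_bigr do rewrite mulrBr.
  rewrite sumrB -mulr_suml mulrDr mulr1 opprB addrAC [RHS]addrA.
  rewrite [h x * _]mulrC -!addrA; congr (_ + _); rewrite addrC; congr (_ - _).
  rewrite (reindex enum_rank)/=; last by apply: onW_bij; exact: enum_rank_bij.
  by apply: eq_bigr => y _; rewrite enum_rankK mulrC.
have Mfree : M \in unitmx.
  rewrite -row_free_unit; apply: inj_row_free => v vM0.
  pose h x := v 0 (enum_rank x).
  have hE x : h x - \sum_y b x y * (h y - h x) = 0.
    by rewrite -ME vM0 mxE.
  have h0 x : h x = 0.
    have [m _ mmax] : exists2 m, true & forall y, `|h y| <= `|h m|.
      case: (@arg_maxP _ _ _ x xpredT (fun y => `|h y|)) => // m _ mm.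
      by exists m => // y; exact: mm.
    apply/eqP; rewrite -normr_le0; apply: le_trans (mmax x) _.
    have := hE m; under eq_bigr do rewrite mulrBr.
    rewrite sumrB -mulr_suml opprB addrA => /eqP.
    rewrite subr_eq0 -[X in X + _]mul1r -mulrDl => /eqP hm.
    have B0 : 0 <= \sum_y b m y by rewrite sumr_ge0.
    have : (1 + \sum_y b m y) * `|h m| <= (\sum_y b m y) * `|h m|.
      rewrite -{1}(@ger0_norm _ (1 + _)) ?addr_ge0// -normrM hm.
      rewrite (le_trans (ler_norm_sum _ _ _))// mulr_suml ler_sum// => y _.
      by rewrite normrM ger0_norm// ler_wpM2l.
    by rewrite mulrDl mul1r gerDr.
  apply/rowP => i; rewrite mxE -(enum_valK i); exact: h0.
pose w : 'rV[R]_n := \row_j u (enum_val j).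
exists (fun x => (w *m invmx M) 0 (enum_rank x)) => x.
by rewrite -ME mulmxKV// mxE enum_rankK.
Qed.

(** * The jump operator on cylindric functions and its resolvent *)

Section jump_operator.
Variables (R : realType) (gamma theta : R).

Definition jump_op n (h : n.-tuple bool -> R) (x : C) : R :=
  gamma * \sum_(1 <= k < n.+1) theta ^+ k * (level_avg h k x - h (cprefix n x)).

Lemma jump_op_extl n (h : n.-tuple bool -> R) x :
  jump_op h (ext (cprefix n x)) = jump_op h x.
Proof.
rewrite /jump_op cprefixK; congr (_ * _); apply: eq_bigr => k _.
congr (_ * (_ * _ - _)); apply: eq_bigl => v.
by rewrite split_level_extl.
Qed.

Lemma jump_opE n (h : n.-tuple bool -> R) :
  jump_op h = (fun v => jump_op h (ext v)) \o cprefix n.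
Proof. by apply/funext => x /=; rewrite jump_op_extl. Qed.

(** The rate of the whole sphere is shared equally by its words; the word of [x] gets 0. *)
Definition jump_rate n (x : C) (v : n.-tuple bool) : R :=
  if (split_level x v <= n)%N
  then gamma * (theta ^+ split_level x v * 2 ^- (n - split_level x v)) else 0.

Lemma jump_op_rate n (h : n.-tuple bool -> R) x :
  jump_op h x = \sum_v jump_rate x v * (h v - h (cprefix n x)).
Proof.
rewrite /jump_op mulr_sumr; set c := h (cprefix n x).
transitivity (\sum_(1 <= k < n.+1) \sum_(v : n.-tuple bool | split_level x v == k)
    jump_rate x v * (h v - c)).
  apply: eq_big_nat => k /andP[k0 kn].
  rewrite level_avgB ?k0// mulrA mulr_sumr mulr_sumr.
  apply: eq_bigr => v /eqP xv; rewrite /jump_rate xv -ltnS kn.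
  by rewrite !mulrA.
rewrite (exchange_big_dep xpredT)//=; apply: eq_bigr => v _.
under eq_bigl do rewrite eq_sym.
rewrite big_nat1_eq; case: ifPn => //; rewrite -leqNgt /jump_rate => nv.
by rewrite leqNgt nv/= mul0r.
Qed.

Hypotheses (gamma0 : 0 <= gamma) (theta0 : 0 <= theta).

Lemma jump_rate_ge0 n (x : C) (v : n.-tuple bool) : 0 <= jump_rate x v.
Proof.
by rewrite /jump_rate; case: ifP => // _; rewrite !mulr_ge0 ?exprn_ge0 ?invr_ge0.
Qed.

(** On functions of [n] coordinates the equation is a finite system with coefficients [jump_rate],
    nonnegative by the signs of [gamma] and [theta]. *)
Lemma jump_op_resolvent n (u : n.-tuple bool -> R) :
  exists h : n.-tuple bool -> R, forall x,
    h (cprefix n x) - jump_op h x = u (cprefix n x).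
Proof.
have [h hu] := @dominant_system_solvable R _
  (fun v w : n.-tuple bool => jump_rate (ext v) w) u (fun v w => jump_rate_ge0 _ _).
exists h => x; rewrite -hu -(jump_op_extl h x) jump_op_rate cprefixK.
by [].
Qed.

End jump_operator.

(** * The generator as the closure of the jump operator *)

Section generator.
Variables (R : realType) (K : {nonneg R} -> R.-pker C ~> C).
Hypothesis Kiso : isometry_invariant K.
Hypothesis Ktrans : transition_function K.
Hypothesis Kfeller : feller K.
Local Notation S := (semigroup K).

Definition generator_at (f g : C -> R) : Prop := forall e : R, 0 < e ->
  exists2 d : R, 0 < d & forall t, 0 < t -> t < d -> forall x,
    `|t^-1 * (S (clip t) f x - f x) - g x| <= e.

Lemma generatorP (f g : {uniform C -> R}) :
  generator K (f, g) <-> continuous (f : C -> R) /\ generator_at f g.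
Proof.
split=> -[/= fc fg]; split => //.
  move=> e e0; apply/near0_gt0.
  have : nbhs g [set g' : {uniform C -> R} | forall x, `|g x - g' x| < e].
    by apply/nbhs_uniform; exists e.
  move=> /fg near_g.
  have {near_g} : \forall t \near 0^'+, forall x,
    `|g x - t^-1 * (S (clip t) f x - f x)| < e := near_g.
  by apply: filterS => t ht x; rewrite distrC; exact/ltW/ht.
move=> B /nbhs_uniform[e e0 eB]; have e20 : 0 < e / 2 by rewrite divr_gt0.
have /near0_gt0 := fg _ e20.
apply: filterS => t /= ht; apply: eB => x; rewrite distrC.
by apply: le_lt_trans (ht x) _; lra.
Qed.

(** [g] is a uniform limit of difference quotients, which are continuous by the Feller property. *)
Lemma generator_at_continuous f g : continuous f -> generator_at f g ->
  continuous (g : C -> R).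
Proof.
move=> fc fg; apply: (@uniform_limit R g) => e e0.
have [d d0 dfg] := fg _ e0; have d20 : 0 < d / 2 by rewrite divr_gt0.
have d2d : d / 2 < d by lra.
exists (fun x => (d / 2)^-1 * (S (clip (d / 2)) f x - f x)).
  move=> x; apply: cvgMr; apply: cvgB; last exact: fc.
  exact: (Kfeller fc).
by move=> x; rewrite distrC; exact: dfg.
Qed.

(* The resolvent estimate: [(1 + 1/t) f = (f - (S^t f - f)/t) + S^t f / t], and
   [S^t] is a contraction. *)
Lemma generator_dissipative f1 g1 f2 g2 e :
  continuous f1 -> continuous f2 -> generator_at f1 g1 -> generator_at f2 g2 ->
  (forall x, `|(f1 x - g1 x) - (f2 x - g2 x)| <= e) ->
  forall x, `|f1 x - f2 x| <= e.
Proof.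
move=> fc1 fc2 fg1 fg2 fge.
pose phi x := f1 x - f2 x.
have phic : continuous phi by move=> x; apply: cvgB; [exact: fc1|exact: fc2].
have [M [M0 phiM]] := continuous_bounded phic.
pose A := range (fun x => `|phi x|).
have Aub : has_ubound A by exists M => _ [x _ <-].
have As x : `|phi x| <= sup A by apply: ub_le_sup => //; exists x.
have A0 : A !=set0 by exists `|phi zeros|, zeros.
suff supe : sup A <= e by move=> x; exact: le_trans (As x) supe.
apply/ler_addgt0Pr => eta eta0.
have eta20 : 0 < eta / 2 by rewrite divr_gt0.
have [d1 d10 fd1] := fg1 _ eta20; have [d2 d20 fd2] := fg2 _ eta20.
pose t := Num.min d1 d2 / 2.
have m0 : 0 < Num.min d1 d2 by rewrite lt_min d10.
have t0 : 0 < t by rewrite divr_gt0.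
have [t1 t2] : t < d1 /\ t < d2.
  apply/andP; rewrite -lt_min /t; lra.
(* The resolvent estimate multiplied by [t]; the term [sup A] then cancels, leaving [e + eta]. *)
have step : (t + 1) * sup A <= t * (e + eta) + sup A.
  rewrite mulrC -ler_pdivlMr ?addr_gt0//.
  apply: ge_sup => // _ [x _ <-]; rewrite ler_pdivlMr ?addr_gt0// mulrC.
  have h1 := fd1 t t0 t1 x; have h2 := fd2 t t0 t2 x; have h3 := fge x.
  have Sphi : `|S (clip t) phi x| <= sup A.
    have S0 : S (clip t) (fun=> 0) x = 0.
      by rewrite /semigroup Rintegral_cst// mul0r.
    rewrite -[S _ _ _]subr0 -S0; apply: semigroup_contraction => //.
      by move=> y; exact: cvg_cst.
    by move=> y; rewrite subr0.
  have SB : S (clip t) phi x = S (clip t) f1 x - S (clip t) f2 x.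
    exact: semigroupB.
  have -> : (t + 1) * `|phi x| = `|(t + 1) * phi x|.
    by rewrite normrM ger0_norm// addr_ge0// ltW.
  have -> : (t + 1) * phi x = t * ((f1 x - g1 x - (f2 x - g2 x)) -
      (t^-1 * (S (clip t) f1 x - f1 x) - g1 x) +
      (t^-1 * (S (clip t) f2 x - f2 x) - g2 x)) + S (clip t) phi x.
    by rewrite SB /phi; field; rewrite gt_eqF.
  rewrite (le_trans (ler_normD _ _))// lerD// normrM gtr0_norm// ler_pM2l//.
  rewrite (le_trans (ler_normD _ _))// (splitr eta) addrA lerD//.
  by rewrite (le_trans (ler_normB _ _))// lerD.
by move: step; rewrite mulrDl mul1r lerD2r ler_pM2l.
Qed.

Lemma semigroup0 n (h : n.-tuple bool -> R) x :
  S (clip 0) (h \o cprefix n) x = h (cprefix n x).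
Proof.
have -> : clip 0 = time0 R by apply/val_inj; rewrite /= maxxx.
rewrite semigroup_sum.
have c0 (v : n.-tuple bool) : cyl_prob K (time0 R) v x = (cprefix n x == v)%:R.
  rewrite /cyl_prob Ktrans.1 ?diracE; last exact: (measurable_cylinder R).
  have [xv|xv] := eqVneq (cprefix n x) v; first by rewrite mem_set.
  by rewrite memNset//= => xv'; rewrite xv' eqxx in xv.
under eq_bigr do rewrite c0.
rewrite (bigD1 (cprefix n x))//= eqxx mulr1 big1 ?addr0// => v /negPf xv.
by rewrite eq_sym xv mulr0.
Qed.

Variables (gamma theta : R) (eps : nat -> R).
Hypothesis eps_lim :
  forall n, (1 - stay K n (clip t)) / t @[t --> 0^'+] --> eps n.
Hypothesis epsE : forall k, (0 < k)%N -> eps k - eps k.-1 = gamma * theta ^+ k.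
Local Notation A := (jump_op gamma theta).

(** Both sides depend only on the prefix, so convergence at the finitely many points [ext v] is
    already uniform. *)
Lemma generator_cylindric n (h : n.-tuple bool -> R) :
  generator_at (h \o cprefix n) (A h).
Proof.
move=> e e0; apply/near0_gt0.
have : \forall t \near 0^'+, forall v : n.-tuple bool,
    `|t^-1 * (S (clip t) (h \o cprefix n) (ext v) - h v) - A h (ext v)| <= e.
  apply: filter_forall => v.
  suff : t^-1 * (S (clip t) (h \o cprefix n) (ext v) - h v) @[t --> 0^'+] -->
      A h (ext v).
    move=> /cvgrPdist_le/(_ _ e0); apply: filterS => t.
    by rewrite distrC.
  rewrite /jump_op mulr_sumr cprefixK.
  rewrite (_ : (fun t : R => _) = (fun t : R => \sum_(1 <= k < n.+1)
      ((1 - stay K k (clip t)) / t - (1 - stay K k.-1 (clip t)) / t) *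
      (level_avg h k (ext v) - h v))).
    rewrite big_nat [X in _ --> X](eq_bigr (fun k => (eps k - eps k.-1) *
      (level_avg h k (ext v) - h v))); last first.
      by move=> k /andP[k0 _]; rewrite epsE// mulrA.
    rewrite -big_nat; apply: cvg_big => [|k _]; first exact: add_continuous.
    by apply: cvgM; [apply: cvgB; exact: eps_lim|exact: cvg_cst].
  apply/funext => t; have := semigroup_level Kiso (clip t) h (ext v).
  rewrite cprefixK => ->; rewrite mulr_sumr; apply: eq_bigr => k _.
  by rewrite mulrA -mulrBl; congr (_ * _); rewrite mulrC; congr (_ * _); lra.
apply: filterS => t ht x.
have := ht (cprefix n x).
by rewrite jump_op_extl (semigroup_cylindric Kiso) /= cprefixK.
Qed.

(** For a cylindric approximant the increment is at most [t * (1 + M)], with [M] a bound of its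
    image under the operator; contraction transfers the estimate to [f]. *)
Lemma semigroup_strongly_continuous (f : C -> R) : continuous f ->
  forall e : R, 0 < e -> exists2 d : R, 0 < d & forall t, 0 <= t -> t < d ->
    forall x, `|S (clip t) f x - f x| <= e.
Proof.
move=> fc e e0; have e30 : 0 < e / 3 by rewrite divr_gt0.
have [n [h [_ fh]]] := cylindric_approx fc e30.
have hc := @continuous_cylindric R n h.
have [d d0 dh] := generator_cylindric h ltr01.
have [M [M0 AM]] : exists M, 0 < M /\ forall x, `|A h x| <= M.
  by rewrite jump_opE; apply: continuous_bounded; exact: continuous_cylindric.
pose d' := e / 3 / (1 + M).
have M1 : 0 < 1 + M by rewrite addr_gt0.
have d'0 : 0 < d' by rewrite divr_gt0.
exists (Num.min d d') => [|t]; first by rewrite lt_min d0.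
have key x : `|S (clip t) (h \o cprefix n) x - h (cprefix n x)| <= e / 3 ->
    `|S (clip t) f x - f x| <= e.
  move=> hx; have fx := fh x.
  have Sx : `|S (clip t) f x - S (clip t) (h \o cprefix n) x| <= e / 3.
    by apply: semigroup_contraction.
  by move: hx fx Sx; rewrite !ler_norml => /andP[? ?] /andP[? ?] /andP[? ?];
    apply/andP; split; lra.
move=> t0; rewrite lt_min => /andP[td td'] x; apply: key.
have [t00|tn0] := eqVneq t 0.
  by rewrite t00 semigroup0 subrr normr0 ltW.
have {t0 tn0} t0 : 0 < t by rewrite lt_neqAle eq_sym tn0.
have := dh t t0 td x; have := AM x; rewrite /=.
set s := S _ _ _ - _ => ax tx.
have sx : `|t^-1 * s| <= 1 + M.
  rewrite -[t^-1 * s](subrK (A h x)) (le_trans (ler_normD _ _))// lerD//.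
move: sx; rewrite normrM gtr0_norm ?invr_gt0// ler_pdivrMl// => sx.
apply: le_trans sx _; rewrite -ler_pdivlMr//; exact: ltW.
Qed.

(* [S^t f - f] telescopes into [m] increments [S^(it/m) (S^(t/m) f - f)], each of
   which is close to [(t/m) S^(it/m) g]. *)
Lemma semigroup_increment n (h : n.-tuple bool -> R) t eta : 0 < t ->
  (forall r, 0 <= r -> r <= t -> forall x, `|S (clip r) (A h) x - A h x| <= eta) ->
  forall x, `|S (clip t) (h \o cprefix n) x - h (cprefix n x) - t * A h x| <= t * eta.
Proof.
move=> t0 Seta x; apply/ler_addgt0Pr => e e0.
(* An error of [s * (e / t)] per step of length [s] adds up to [e] over the whole time [t]. *)
have et0 : 0 < e / t by rewrite divr_gt0.
have [d d0 dh] := generator_cylindric h et0.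
pose m := Num.truncn (t / d); pose s := t / m.+1%:R.
have s0 : 0 < s by rewrite divr_gt0.
have sd : s < d by rewrite ltr_pdivrMr// mulrC -ltr_pdivrMr// truncnS_gt.
have tE : t = m.+1%:R * s by rewrite mulrC divfK.
pose f := h \o cprefix n.
have fc : continuous f := @continuous_cylindric R n h.
have gc : continuous (A h) by rewrite jump_opE; exact: continuous_cylindric.
have sgc : continuous (fun y => s * A h y) by move=> y; apply: cvgMr; exact: gc.
have Sfc : continuous (S (clip s) f) := Kfeller fc.
have fsg : continuous (fun y => f y + s * A h y).
  by move=> y; apply: cvgD; [exact: fc|exact: sgc].
have step y : `|S (clip s) f y - (f y + s * A h y)| <= s * (e / t).
  have := dh s s0 sd y; rewrite -(ler_pM2l s0) -{1}(gtr0_norm s0) -normrM mulrBr.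
  by rewrite mulrA divff ?gt_eqF// mul1r opprD addrA.
have claim i : (i <= m.+1)%N ->
    `|S (clip (i%:R * s)) f x - f x - (i%:R * s) * A h x| <= i%:R * s * (e / t + eta).
  elim: i => [_|i IH im].
    by rewrite !mul0r semigroup0 subrr subr0 normr0.
  have is0 : 0 <= i%:R * s by rewrite mulr_ge0// ltW.
  have ist : i%:R * s <= t by rewrite tE ler_pM2r// ler_nat ltnW.
  pose X := S (clip (i.+1%:R * s)) f x; pose Y := S (clip (i%:R * s)) f x.
  pose Z := S (clip (i%:R * s)) (A h) x.
  have h1 : `|X - (Y + s * Z)| <= s * (e / t).
    rewrite /X /Y /Z -natr1 mulrDl mul1r clipD// ?(ltW s0)//.
    rewrite (semigroup_add Kiso Ktrans) -semigroupZ// -semigroupD//.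
    exact: semigroup_contraction.
  have h2 : `|Z - A h x| <= eta := Seta _ is0 ist x.
  have h3 := IH (ltnW im); rewrite -/Y in h3; rewrite -/X.
  have -> : X - f x - i.+1%:R * s * A h x = (X - (Y + s * Z)) +
      s * (Z - A h x) + (Y - f x - i%:R * s * A h x).
    by rewrite -natr1; ring.
  have -> : i.+1%:R * s * (e / t + eta) = s * (e / t) + s * eta +
      i%:R * s * (e / t + eta).
    by rewrite -natr1; ring.
  rewrite (le_trans (ler_normD _ _))// lerD// (le_trans (ler_normD _ _))// lerD//.
  by rewrite normrM gtr0_norm// ler_pM2l.
have := claim _ (leqnn m.+1); rewrite -tE => /le_trans; apply.
by rewrite mulrDr mulrC divfK ?gt_eqF// addrC mulrC.
Qed.

Lemma generator_closed (f g : {uniform C -> R}) :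
  closure (cylindric_operator gamma theta) (f, g) -> generator K (f, g).
Proof.
move=> /closure_uniform cl; apply/generatorP.
have fc : continuous (f : C -> R).
  apply: uniform_limit => e /cl[f' [g' [[n [h [_ /= -> _]]] fg]]].
  exists (h \o cprefix n); first exact: continuous_cylindric.
  by move=> x; apply/ltW; have [] := fg x.
have gc : continuous (g : C -> R).
  apply: uniform_limit => e /cl[f' [g' [[n [h [_ /= _ ->]]] fg]]].
  exists (A h); first by rewrite jump_opE; exact: continuous_cylindric.
  by move=> x; apply/ltW; have [] := fg x.
split => // e e0; have e60 : 0 < e / 6 by rewrite divr_gt0.
have [d d0 dg] := semigroup_strongly_continuous gc e60.
exists d => // t t0 td x.
(* The approximant is chosen after [t], because the quotient divides the error on [f] by [t]; the
   range [d] depends on [g] alone. In units of [t * (e / 6)], the increment costs 3, replacing [f]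
   costs 2 and replacing [g] costs 1. *)
pose e' := Num.min (e / 6) (t * (e / 6)).
have e'0 : 0 < e' by rewrite lt_min e60 mulr_gt0.
have [e'1 e'2] : e' <= e / 6 /\ e' <= t * (e / 6).
  by apply/andP; rewrite -le_min.
have [f' [g' [[n [h [_ /= f'E g'E]]] fg]]] := cl _ e'0.
have {g'E}g'E : g' = A h by [].
have f'c : continuous (f' : C -> R) by rewrite f'E; exact: continuous_cylindric.
have g'c : continuous (g' : C -> R).
  by rewrite g'E jump_opE; exact: continuous_cylindric.
have ff' y : `|f y - f' y| <= e' by have [/ltW] := fg y.
have gg' y : `|g y - g' y| <= e' by have [_ /ltW] := fg y.
have Sg' r : 0 <= r -> r <= t -> forall y, `|S (clip r) (A h) y - A h y| <= e / 2.
  move=> r0 rt y; rewrite -g'E.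
  have a := dg r r0 (le_lt_trans rt td) y; have b := gg' y.
  have c : `|S (clip r) g y - S (clip r) g' y| <= e' by exact: semigroup_contraction.
  by move: a b c; rewrite !ler_norml => /andP[? ?] /andP[? ?] /andP[? ?];
    apply/andP; split; lra.
have inc := semigroup_increment t0 Sg' x.
have Sf : `|S (clip t) f x - S (clip t) f' x| <= e' by exact: semigroup_contraction.
have fx := ff' x; have gx := gg' x.
rewrite -(ler_pM2l t0) -{1}(gtr0_norm t0) -normrM mulrBr mulrA divff ?gt_eqF// mul1r.
have tg : `|t * g x - t * g' x| <= t * (e / 6).
  by rewrite -mulrBr normrM gtr0_norm// ler_pM2l// (le_trans gx).
rewrite -[h _]/((h \o cprefix n) x) -f'E -g'E in inc.
move: inc Sf fx tg; rewrite !ler_norml.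
move: (S _ f x) (S _ f' x) (f x) (f' x) (t * g x) (t * g' x) => a1 a2 a3 a4 a5 a6.
have -> : t * (e / 2) = 3 * (t * (e / 6)) by lra.
have -> : t * e = 6 * (t * (e / 6)) by lra.
move: (t * (e / 6)) e'2 => q e'2.
by move=> /andP[? ?] /andP[? ?] /andP[? ?] /andP[? ?]; apply/andP; split; lra.
Qed.

Hypotheses (gamma0 : 0 <= gamma) (theta0 : 0 <= theta).

(** A cylindric [u] close to [f - g] is [h - A h] for some cylindric [h]. Dissipativity makes [h]
    close to [f], and then [A h = h - u] is close to [g]. *)
Lemma generator_core (f g : {uniform C -> R}) :
  generator K (f, g) -> closure (cylindric_operator gamma theta) (f, g).
Proof.
move=> /generatorP[fc fg]; apply/closure_uniform => e e0.
have gc := generator_at_continuous fc fg.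
have e30 : 0 < e / 3 by rewrite divr_gt0.
have uc : continuous (fun x : C => f x - g x).
  by move=> x; apply: cvgB; [exact: fc|exact: gc].
have [n [u [n0 fgu]]] := cylindric_approx uc e30.
have [h hu] := jump_op_resolvent gamma0 theta0 u.
exists (h \o cprefix n), (A h); split; first by exists n, h.
have dis : forall x, `|f x - (h \o cprefix n) x| <= e / 3.
  apply: (generator_dissipative fc (@continuous_cylindric R n h) fg (generator_cylindric h)).
  by move=> x /=; rewrite hu.
move=> x; have a := dis x; have b := fgu x; rewrite -hu in b; split.
  by apply: le_lt_trans a _; lra.
move: a b => /=; rewrite !ler_norml ltr_norml => /andP[? ?] /andP[? ?].
by apply/andP; split; lra.
Qed.

End generator.

Theorem theorem2 (R : realType)
    (K : {nonneg R} -> R.-pker cantor_space ~> cantor_space)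
    (P : cantor_space -> probability (cadlag_path R) R) :
  sss K P ->
  exists gamma theta : R, [/\ 0 <= gamma, 0 <= theta &
    generator K = closure (cylindric_operator gamma theta)].
Proof.
move=> [markov Kcont Kfeller Kiso Pss].
have Ktrans : transition_function K by case: markov.
have /choice[eps eps_lim] := stay_derivative Kiso Ktrans Kcont.
have [gamma [theta [gamma0 theta0 epsE]]] :=
  geometric_rates markov Kiso eps_lim Pss.
exists gamma, theta; split => //; apply/seteqP; split => -[f g].
  exact: (generator_core Kiso Kfeller eps_lim epsE gamma0 theta0).
exact: (generator_closed Kiso Ktrans Kfeller eps_lim epsE).
Qed.
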